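(* Let $\phi$ be a family of supports in a topological space $X$ and $\mathcal B$ a sheaf (possibly twisted) on $X$. If $\mathcal L^*$ is a resolvent of the sheaf $\mathcal B$ consisting of $\phi$-acyclic sheaves, then for each $b\in\mathbf N$ the natural mapping $$\kappa:{\sf H}^b(\Gamma_\phi(\mathcal L^* ))\to{\sf H}^b_\phi(X;\mathcal B)$$ is an isomorphism.
   Context: A sheaf is a sheaf of groups, commutative or twisted. A group $G$ (not necessarily associative) is twisted over the standard generators $\{i_0,\dots,i_{2^r-1}\}$ of $\mathcal A_r$ ($\mathcal A_1=\mathbf C$, $\mathcal A_2=\mathbf H$, $\mathcal A_3=\mathbf O$) if it is alternative ($g(gf)=(gg)f$, $(fg)g=f(gg)$, $g^{-1}(gf)=f$, $(fg)g^{-1}=f$), has a conjugation automorphism with $conj(gf)=conj(f)conj(g)$, $conj(e)=e$, and is the multiplicative group of a ring $\hat G=\hat G_0i_0\oplus\dots\oplus\hat G_{2^r-1}i_{2^r-1}$ with pairwise isomorphic commutative associative rings $\hat G_j$ and $(y_li_l)(y_si_s)=(y_ly_s)(i_li_s)$. A twisted sheaf has twisted groups over open sets; differentials $d:\mathcal S^m\to\mathcal S^{m+1}$ of twisted differential sheaves are supposed to satisfy $\theta_{m+1}\circ d(\mathcal S^m_k)\subset\mathcal S^{m+1}_k$ for every $k=0,\dots,2^r-1$ up to automorphisms $\theta_m$ of $\mathcal S^m$. A family of supports $\phi$ is a family of closed subsets of $X$ closed under taking closed subsets and finite unions. $\Gamma_\phi(\mathcal S)=\{s\in\mathcal S(X):|s|\in\phi\}$,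 $|s|=\{x:s(x)\ne e\}$. A resolvent of $\mathcal B$ is a differential sheaf $\mathcal L^*$ ($d^2=0$, $\mathcal L^m=0$ for $m<0$) with augmentation $\varepsilon:\mathcal B\to\mathcal L^0$ such that $e\to\mathcal B\to\mathcal L^0\to\mathcal L^1\to\cdots$ is exact. Cohomology: ${\cal Y}^0(X;\mathcal B)$ is the sheaf $U\mapsto\prod_{x\in U}\mathcal B_x$ of all (possibly discontinuous) sections; ${\cal Z}^1(X;\mathcal B)$ is the cokernel of the inclusion $\mathcal B\to{\cal Y}^0(X;\mathcal B)$; ${\cal Z}^0(X;\mathcal B)=\mathcal B$, ${\cal Y}^m(X;\mathcal B)={\cal Y}^0(X;{\cal Z}^m(X;\mathcal B))$, ${\cal Z}^{m+1}(X;\mathcal B)={\cal Z}^1(X;{\cal Z}^m(X;\mathcal B))$; these give the canonical resolvent ${\cal Y}^*(X;\mathcal B)$, and ${\sf H}^m_\phi(X;\mathcal B):={\sf H}^m(\Gamma_\phi({\cal Y}^*(X;\mathcal B)))$. A sheaf $\mathcal L$ is $\phi$-acyclic if ${\sf H}^b_\phi(X;\mathcal L)=0$ for each $b>0$. A short exact sequence of sheaves induces a long exact cohomology sequence. The map $\kappa$: put $\mathcal Z^b:=Ker(\mathcal L^b\to\mathcal L^{b+1})=Im(\mathcal L^{b-1}\to\mathcal L^b)$, $\mathcal Z^0=\mathcal B$. The exact sequences $e\to\mathcal Z^{b-1}\to\mathcal L^{b-1}\to\mathcal Z^b\to e$ and $e\to\mathcal Z^{b-v}\to\mathcal L^{b-v}\to\mathcal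 Z^{b-v+1}\to e$ induce a monomorphism ${\sf H}^b(\Gamma_\phi(\mathcal L^* ))=\Gamma_\phi(\mathcal Z^b)/Im(\Gamma_\phi(\mathcal L^{b-1})\to\Gamma_\phi(\mathcal Z^b))\to{\sf H}^1_\phi(X;\mathcal Z^{b-1})$ and connecting homomorphisms ${\sf H}^{v-1}_\phi(X;\mathcal Z^{b-v+1})\to{\sf H}^v_\phi(X;\mathcal Z^{b-v})$; $\kappa$ is the composition ${\sf H}^b(\Gamma_\phi(\mathcal L^* ))\to{\sf H}^1_\phi(X;\mathcal Z^{b-1})\to{\sf H}^2_\phi(X;\mathcal Z^{b-2})\to\cdots\to{\sf H}^b_\phi(X;\mathcal Z^0)$.
   Formalization: In the twisted case it is assumed, for all L^m and Z^m (Z^0 = B), that the canonical resolvent Y^* really is a resolvent and its coboundaries with supports are normal in the cocycles; this can fail for noncommutative sheaves, e.g. constant H^* on the Sierpinski space, where the claim fails at b=0. *)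

(* Defs.v *)
From HB Require Import structures.
From mathcomp Require Import all_boot all_algebra.
From mathcomp Require Import boolp classical_sets topology.

Set Implicit Arguments.
Unset Strict Implicit.
Unset Printing Implicit Defensive.

Local Open Scope classical_set_scope.
Local Open Scope group_scope.

(* Lets one write [U x] for [x : X] and [U] an open set or a subgroup. *)
Identity Coercion set_pred : set >-> Funclass.

HB.mixin Record BaseGroup_isAltGroup G of BaseGroup G := {
  amul1g : forall g : G, 1 * g = g;
  amulg1 : forall g : G, g * 1 = g;
  amulgA : forall g f : G, g * (g * f) = (g * g) * f;
  amulAg : forall f g : G, (f * g) * g = f * (g * g);
  amulKg : forall g f : G, g^-1 * (g * f) = f;
  amulgK : forall f g : G, (f * g) * g^-1 = f
}.

#[short(type="altGroupType")]
HB.structure Definition AltGroup := {G of BaseGroup_isAltGroup G & BaseGroup G}.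

(* The multiplication of an [altGroupType] is not assumed associative; the
   alternative and inverse laws are the only substitutes. *)
Definition commutative_group (G : altGroupType) : Prop :=
  (forall a b : G, a * b = b * a) /\ (forall a b c : G, a * (b * c) = (a * b) * c).

Lemma amulVg (G : altGroupType) (g : G) : g^-1 * g = 1.
Proof. by have := amulKg g 1; rewrite amulg1. Qed.

Lemma amulgV (G : altGroupType) (g : G) : g * g^-1 = 1.
Proof. by have := amulgK 1 g; rewrite amul1g. Qed.

Lemma amul_inv_uniq (G : altGroupType) (g h : G) : g * h = 1 -> h = g^-1.
Proof. by move=> gh; rewrite -[LHS](amulKg g) gh amulg1. Qed.

Lemma ainv1 (G : altGroupType) : (1 : G)^-1 = 1.
Proof. by rewrite -[LHS]amul1g amulgV. Qed.

Lemma amorph1 (G H : altGroupType) (f : {multiplicative G -> H}) : f 1 = 1.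
Proof. by rewrite -[LHS](amulKg (f 1)) -gmulfM amul1g amulVg. Qed.

Lemma amorphV (G H : altGroupType) (f : {multiplicative G -> H}) (g : G) :
  f g^-1 = (f g)^-1.
Proof. by apply: amul_inv_uniq; rewrite -gmulfM amulgV amorph1. Qed.

Definition bundle_hom (G H : altGroupType) (f : G -> H)
    (fM : {morph f : x y / x * y}) : {multiplicative G -> H} :=
  HB.pack f (isMultiplicative.Build G H f fM).

Definition prodg (I : Type) (G : I -> altGroupType) : Type := forall i, G i.

HB.instance Definition _ I G := hasMul.Build (@prodg I G)
  (fun a b i => a i * b i).
HB.instance Definition _ I G := hasOne.Build (@prodg I G) (fun i => 1).
HB.instance Definition _ I G := hasInv.Build (@prodg I G) (fun a i => (a i)^-1).

Fact prodg_axioms I (G : I -> altGroupType) : BaseGroup_isAltGroup (prodg G).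
Proof.
split=> *; apply: functional_extensionality_dep => i.
- exact: amul1g.
- exact: amulg1.
- exact: amulgA.
- exact: amulAg.
- exact: amulKg.
- exact: amulgK.
Qed.
HB.instance Definition _ I G := @prodg_axioms I G.

Record subgroup (G : altGroupType) := Subgroup {
  subgroup_set :> set G;
  subgroup1 : subgroup_set 1;
  subgroupM : forall a b,
    subgroup_set a -> subgroup_set b -> subgroup_set (a * b);
  subgroupV : forall a, subgroup_set a -> subgroup_set a^-1 }.

Definition subgT (G : altGroupType) (A : subgroup G) : Type := {a : G | A a}.

HB.instance Definition _ G A := hasMul.Build (@subgT G A)
  (fun a b => exist _ (sval a * sval b) (subgroupM (svalP a) (svalP b))).
HB.instance Definition _ G A := hasOne.Build (@subgT G A)
  (exist _ 1 (subgroup1 A)).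
HB.instance Definition _ G A := hasInv.Build (@subgT G A)
  (fun a => exist _ (sval a)^-1 (subgroupV (svalP a))).

Lemma subgT_inj (G : altGroupType) (A : subgroup G) (a b : subgT A) :
  sval a = sval b -> a = b.
Proof. by case: a b => [a Aa] [b Ab] /= ab; apply: eq_exist. Qed.

Fact subg_axioms G (A : subgroup G) : BaseGroup_isAltGroup (subgT A).
Proof.
split=> *; apply: subgT_inj => /=.
- exact: amul1g.
- exact: amulg1.
- exact: amulgA.
- exact: amulAg.
- exact: amulKg.
- exact: amulgK.
Qed.
HB.instance Definition _ G A := @subg_axioms G A.

Definition kerg (G H : altGroupType) (f : {multiplicative G -> H}) : subgroup G.
Proof.
apply: (@Subgroup _ [set a | f a = 1]) => /=; first exact: amorph1.
- by move=> a b fa fb; rewrite gmulfM fa fb amul1g.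
- by move=> a fa; rewrite amorphV fa ainv1.
Defined.

Definition quot (T : Type) (R : T -> T -> Prop) : Type :=
  {A : set T | exists a, A = R a}.

Definition cls (T : Type) (R : T -> T -> Prop) (a : T) : quot R :=
  exist _ (R a) (ex_intro _ a erefl).

Definition repr (T : Type) (R : T -> T -> Prop) (q : quot R) : T :=
  sval (cid (svalP q)).

Lemma reprK T (R : T -> T -> Prop) (q : quot R) : cls R (repr q) = q.
Proof.
by case: q => A Aq; apply: eq_exist; rewrite /repr; case: cid.
Qed.

Record equivalence (T : Type) (R : T -> T -> Prop) : Prop := Equiv {
  eqv_refl : forall a, R a a;
  eqv_sym : forall a b, R a b -> R b a;
  eqv_trans : forall a b c, R a b -> R b c -> R a c }.

Lemma clsP T (R : T -> T -> Prop) (eR : equivalence R) a b :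
  cls R a = cls R b <-> R a b.
Proof.
split=> [/(congr1 sval)/= ->|Rab]; first exact: eqv_refl.
apply: eq_exist; apply/seteqP; split=> c /= Rc.
- exact: eqv_trans eR _ _ _ (eqv_sym eR Rab) Rc.
- exact: eqv_trans eR _ _ _ Rab Rc.
Qed.

Lemma repr_cls T (R : T -> T -> Prop) (eR : equivalence R) a :
  R (repr (cls R a)) a.
Proof. by apply/(clsP eR); rewrite reprK. Qed.

Record congruence (G : altGroupType) (R : G -> G -> Prop) : Prop := Congruence {
  cong_equiv : equivalence R;
  congM : forall a a' b b', R a a' -> R b b' -> R (a * b) (a' * b');
  congV : forall a a', R a a' -> R a^-1 a'^-1 }.

(* The least congruence that identifies every element of [N] with 1.  When [N]
   is a normal_set subgroup of an associative group, its classes are the cosets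
   of [N]. *)
Definition gencong (G : altGroupType) (N : set G) (a b : G) : Prop :=
  forall R : G -> G -> Prop,
    congruence R -> (forall n, N n -> R n 1) -> R a b.

Lemma gencongP (G : altGroupType) (N : set G) : congruence (gencong N).
Proof.
split; first split.
- by move=> a R [eR _ _] _; apply: eqv_refl.
- by move=> a b ab R cR NR; apply: eqv_sym (cong_equiv cR) _ _ (ab R cR NR).
- move=> a b c ab bc R cR NR.
  exact: eqv_trans (cong_equiv cR) _ _ _ (ab R cR NR) (bc R cR NR).
- by move=> a a' b b' aa bb R cR NR; apply: congM (aa R cR NR) (bb R cR NR).
- by move=> a a' aa R cR NR; apply: congV (aa R cR NR).
Qed.

Lemma gencong_equiv (G : altGroupType) (N : set G) : equivalence (gencong N).
Proof. exact: cong_equiv (gencongP N). Qed.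

Lemma gencong_gen (G : altGroupType) (N : set G) n : N n -> gencong N n 1.
Proof. by move=> Nn R _; apply. Qed.

Lemma gencong_map (G H : altGroupType) (N : set G) (M : set H)
    (f : {multiplicative G -> H}) (fNM : forall n, N n -> M (f n)) a b :
  gencong N a b -> gencong M (f a) (f b).
Proof.
have [[r s t] m i] := gencongP M => ab.
apply: (ab (fun x y => gencong M (f x) (f y))); last first.
  by move=> n /fNM/gencong_gen; rewrite amorph1.
split; first by split; eauto.
- by move=> *; rewrite !gmulfM; apply: m.
- by move=> *; rewrite !amorphV; apply: i.
Qed.

Definition quotg (G : altGroupType) (N : set G) : Type := quot (gencong N).

HB.instance Definition _ G N := hasMul.Build (@quotg G N)
  (fun a b => cls _ (repr a * repr b)).
HB.instance Definition _ G N := hasOne.Build (@quotg G N) (cls _ 1).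
HB.instance Definition _ G N := hasInv.Build (@quotg G N)
  (fun a => cls _ (repr a)^-1).

Definition qproj (G : altGroupType) (N : set G) (a : G) : quotg N := cls _ a.

Lemma qprojP (G : altGroupType) (N : set G) a b :
  qproj N a = qproj N b <-> gencong N a b.
Proof. exact: clsP (gencong_equiv N) a b. Qed.

Lemma qproj_repr (G : altGroupType) (N : set G) (q : quotg N) :
  qproj N (repr q) = q.
Proof. exact: reprK. Qed.

Lemma qprojM (G : altGroupType) (N : set G) :
  {morph @qproj G N : x y / x * y}.
Proof.
move=> x y; apply/esym/qprojP.
by apply: congM (gencongP N) _ _ _ _ _ _; apply: repr_cls (gencong_equiv N) _.
Qed.
HB.instance Definition _ (G : altGroupType) (N : set G) :=
  isMultiplicative.Build G (quotg N) (@qproj G N) (@qprojM G N).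

Lemma qprojV (G : altGroupType) (N : set G) (a : G) :
  (qproj N a)^-1 = qproj N a^-1.
Proof.
apply/qprojP; apply: congV (gencongP N) _ _ _.
exact: repr_cls (gencong_equiv N) _.
Qed.

Fact quotg_axioms (G : altGroupType) (N : set G) : BaseGroup_isAltGroup (quotg N).
Proof.
split=> a; rewrite -(qproj_repr a); move: (repr a) => {}a.
- by rewrite -[1]/(qproj N 1) -(qprojM N 1 a) amul1g.
- by rewrite -[1]/(qproj N 1) -(qprojM N a 1) amulg1.
- move=> b; rewrite -(qproj_repr b); move: (repr b) => {}b.
  by rewrite -(qprojM N a b) -(qprojM N a a) -(qprojM N a (a * b))
    -(qprojM N (a * a) b) amulgA.
- move=> b; rewrite -(qproj_repr b); move: (repr b) => {}b.
  by rewrite -(qprojM N a b) -(qprojM N b b) -(qprojM N (a * b) b)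
    -(qprojM N a (b * b)) amulAg.
- move=> b; rewrite -(qproj_repr b); move: (repr b) => {}b.
  by rewrite (qprojV N a) -(qprojM N a b) -(qprojM N a^-1 (a * b)) amulKg.
- move=> b; rewrite -(qproj_repr b); move: (repr b) => {}b.
  by rewrite (qprojV N b) -(qprojM N a b) -(qprojM N (a * b) b^-1) amulgK.
Qed.
HB.instance Definition _ G N := @quotg_axioms G N.

Definition quotg_map (G H : altGroupType) (N : set G) (M : set H)
  (f : {multiplicative G -> H}) (q : quotg N) : quotg M := qproj M (f (repr q)).

Lemma quotg_mapE (G H : altGroupType) (N : set G) (M : set H)
    (f : {multiplicative G -> H}) (fNM : forall n, N n -> M (f n)) (a : G) :
  quotg_map M f (qproj N a) = qproj M (f a).
Proof.
apply/qprojP; apply: (gencong_map fNM).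
exact: repr_cls (gencong_equiv N) a.
Qed.

Lemma quotg_mapM (G H : altGroupType) (N : set G) (M : set H)
    (f : {multiplicative G -> H}) (fNM : forall n, N n -> M (f n)) :
  {morph @quotg_map G H N M f : x y / x * y}.
Proof.
move=> x y; rewrite -(qproj_repr x) -(qproj_repr y).
move: (repr x) (repr y) => {}x {}y.
by rewrite -(qprojM N x y) !(quotg_mapE fNM) gmulfM qprojM.
Qed.

(* [N] is the kernel of [G -> G / N]. *)
Definition normal_set (G : altGroupType) (N : set G) : Prop :=
  forall a, qproj N a = 1 <-> N a.

Record opens (X : topologicalType) := Opens {
  open_set :> set X;
  open_setP : open open_set }.

Definition fullO (X : topologicalType) : opens X := Opens (@openT X).
Definition capO (X : topologicalType) (U V : opens X) : opens X :=
  Opens (openI (open_setP U) (open_setP V)).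

Lemma capOl (X : topologicalType) (U V : opens X) : capO U V `<=` U.
Proof. by move=> x []. Qed.
Lemma capOr (X : topologicalType) (U V : opens X) : capO U V `<=` V.
Proof. by move=> x []. Qed.

Record presheaf (X : topologicalType) := Presheaf {
  sec :> opens X -> altGroupType;
  res : forall U V : opens X, V `<=` U -> {multiplicative sec U -> sec V};
  res_id : forall (U : opens X) (UU : U `<=` U) s, res UU s = s;
  res_comp : forall (U V W : opens X)
    (VU : V `<=` U) (WV : W `<=` V) (WU : W `<=` U) s,
    res WV (res VU s) = res WU s }.

Arguments res {X p U V} VU.

Record sheaf (X : topologicalType) := Sheaf {
  sheaf_presheaf :> presheaf X;
  sheaf_locality : forall (U : opens X) (s t : sheaf_presheaf U),
    (forall x, U x -> exists (V : opens X) (VU : V `<=` U),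
       V x /\ res VU s = res VU t) -> s = t;
  sheaf_gluing : forall (U : opens X) (I : Type) (V : I -> opens X)
    (VU : forall i, V i `<=` U) (s : forall i, sheaf_presheaf (V i)),
    U `<=` \bigcup_i V i ->
    (forall i j (W : opens X) (Wi : W `<=` V i) (Wj : W `<=` V j),
       res Wi (s i) = res Wj (s j)) ->
    exists t : sheaf_presheaf U, forall i, res (VU i) t = s i }.

Record sheaf_hom (X : topologicalType) (F G : presheaf X) := SheafHom {
  hom_sec :> forall U, {multiplicative F U -> G U};
  hom_res : forall (U V : opens X) (VU : V `<=` U) s,
    hom_sec V (res VU s) = res VU (hom_sec U s) }.

Definition hom_comp_sec X (F G H : presheaf X)
    (g : sheaf_hom G H) (f : sheaf_hom F G) (U : opens X) :
  {multiplicative F U -> H U} := g U \o f U.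

Fact hom_comp_res X (F G H : presheaf X)
    (g : sheaf_hom G H) (f : sheaf_hom F G) (U V : opens X) (VU : V `<=` U) s :
  hom_comp_sec g f V (res VU s) = res VU (hom_comp_sec g f U s).
Proof. by rewrite /= !hom_res. Qed.

Definition hom_comp X (F G H : presheaf X)
  (g : sheaf_hom G H) (f : sheaf_hom F G) : sheaf_hom F H :=
  SheafHom (hom_comp_res g f).

Record pregerm (X : topologicalType) (F : presheaf X) (x : X) := Pregerm {
  pg_dom : opens X;
  pg_in : pg_dom x;
  pg_sec : F pg_dom }.

Definition germ_eq X (F : presheaf X) (x : X) (a b : pregerm F x) : Prop :=
  exists (W : opens X) (Wa : W `<=` pg_dom a) (Wb : W `<=` pg_dom b),
    W x /\ res Wa (pg_sec a) = res Wb (pg_sec b).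

Fact germ_eq_equiv X (F : presheaf X) x : equivalence (@germ_eq X F x).
Proof.
split.
- move=> a; exists (pg_dom a), (@subset_refl _ _), (@subset_refl _ _).
  by split=> //; apply: pg_in.
- by move=> a b [W [Wa [Wb [Wx ab]]]]; exists W, Wb, Wa.
- move=> a b c [W [Wa [Wb [Wx ab]]]] [W' [Wb' [Wc [Wx' bc]]]].
  have WW : capO W W' `<=` W by move=> y [].
  have WW' : capO W W' `<=` W' by move=> y [].
  exists (capO W W'), (subset_trans WW Wa), (subset_trans WW' Wc).
  split=> //; rewrite -(res_comp Wa WW) ab -(res_comp Wc WW') -bc.
  have WWb := subset_trans WW Wb.
  by rewrite (res_comp Wb WW WWb) (res_comp Wb' WW' WWb).
Qed.

Definition stalk (X : topologicalType) (F : presheaf X) (x : X) : Type :=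
  quot (@germ_eq X F x).

Definition germ X (F : presheaf X) (U : opens X) (s : F U) (x : X) (Ux : U x) :
  stalk F x := cls _ (Pregerm Ux s).

Lemma germP X (F : presheaf X) (U V : opens X) (s : F U) (t : F V) x
    (Ux : U x) (Vx : V x) :
  germ s Ux = germ t Vx <->
  exists (W : opens X) (WU : W `<=` U) (WV : W `<=` V),
    W x /\ res WU s = res WV t.
Proof. exact: clsP (germ_eq_equiv F x) _ _. Qed.

Lemma germ_resE X (F : presheaf X) (U V : opens X) (VU : V `<=` U) (s : F U) x
    (Ux : U x) (Vx : V x) : germ (res VU s) Vx = germ s Ux.
Proof.
apply/germP; exists V, (@subset_refl _ _), VU; split=> //.
by rewrite res_id.
Qed.

Lemma germ_ex X (F : presheaf X) x (a : stalk F x) :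
  exists (U : opens X) (Ux : U x) (s : F U), a = germ s Ux.
Proof.
by rewrite -(reprK a); case: (repr a) => U Ux s; exists U, Ux, s.
Qed.

Definition stalk_mul X (F : presheaf X) x (a b : stalk F x) : stalk F x :=
  let a' := repr a in let b' := repr b in
  @germ X F (capO (pg_dom a') (pg_dom b'))
    (res (@capOl X _ _) (pg_sec a') * res (@capOr X _ _) (pg_sec b'))
    x (conj (pg_in a') (pg_in b')).
Definition stalk_one X (F : presheaf X) x : stalk F x :=
  @germ X F (fullO X) 1 x I.
Definition stalk_inv X (F : presheaf X) x (a : stalk F x) : stalk F x :=
  let a' := repr a in germ (pg_sec a')^-1 (pg_in a').

HB.instance Definition _ X F x := hasMul.Build (@stalk X F x) (@stalk_mul X F x).
HB.instance Definition _ X F x := hasOne.Build (@stalk X F x) (@stalk_one X F x).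
HB.instance Definition _ X F x := hasInv.Build (@stalk X F x) (@stalk_inv X F x).

Lemma germ1 X (F : presheaf X) (U : opens X) x (Ux : U x) :
  germ (1 : F U) Ux = 1.
Proof.
apply/germP; exists U, (@subset_refl _ _), (fun _ _ => I); split=> //.
by rewrite !amorph1.
Qed.

Lemma germM X (F : presheaf X) (U : opens X) (s t : F U) x (Ux : U x) :
  germ (s * t) Ux = germ s Ux * germ t Ux.
Proof.
rewrite -[RHS]/(stalk_mul _ _) /stalk_mul.
have := repr_cls (germ_eq_equiv F x) (Pregerm Ux s).
have := repr_cls (germ_eq_equiv F x) (Pregerm Ux t).
rewrite -/(germ s Ux) -/(germ t Ux).
case: (repr (germ s Ux)) (repr (germ t Ux)) => [V Vx s'] [V' Vx' t'] /=.
move=> [W [/= WV' [WU [Wx tt]]]] [W' [/= WV [WU' [Wx' ss]]]].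
apply/esym/germP.
have WW : capO W W' `<=` W by move=> y [].
have WW' : capO W W' `<=` W' by move=> y [].
have A : capO W W' `<=` capO V V' by move=> y [y1 y2]; split; auto.
exists (capO W W'), A, (subset_trans WW WU); split=> //.
rewrite !gmulfM; congr (_ * _).
- rewrite (res_comp _ _ (subset_trans WW' WV)) -(res_comp WV WW') ss.
  by rewrite (res_comp _ _ (subset_trans WW WU)).
- rewrite (res_comp _ _ (subset_trans WW WV')) -(res_comp WV' WW) tt.
  by rewrite (res_comp _ _ (subset_trans WW WU)).
Qed.

Lemma germV X (F : presheaf X) (U : opens X) (s : F U) x (Ux : U x) :
  germ s^-1 Ux = (germ s Ux)^-1.
Proof.
rewrite -[RHS]/(stalk_inv _) /stalk_inv.
have := repr_cls (germ_eq_equiv F x) (Pregerm Ux s).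
rewrite -/(germ s Ux); case: (repr (germ s Ux)) => [V Vx s'] /=.
move=> [W [/= WV [WU [Wx ss]]]]; apply/esym/germP.
by exists W, WV, WU; split=> //; rewrite !amorphV ss.
Qed.

Lemma germ_ex2 X (F : presheaf X) x (a b : stalk F x) :
  exists (U : opens X) (Ux : U x) (s t : F U), a = germ s Ux /\ b = germ t Ux.
Proof.
have [U [Ux [s ->]]] := germ_ex a; have [V [Vx [t ->]]] := germ_ex b.
have UVx : capO U V x by split.
exists (capO U V), UVx, (res (@capOl X _ _) s), (res (@capOr X _ _) t).
by split; rewrite germ_resE.
Qed.

Fact stalk_axioms X (F : presheaf X) x : BaseGroup_isAltGroup (stalk F x).
Proof.
split.
- by move=> a; have [U [Ux [s ->]]] := germ_ex a;
     rewrite -(germ1 F Ux) -germM amul1g.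
- by move=> a; have [U [Ux [s ->]]] := germ_ex a;
     rewrite -(germ1 F Ux) -germM amulg1.
- by move=> a b; have [U [Ux [s [t [-> ->]]]]] := germ_ex2 a b;
     rewrite -!germM amulgA.
- by move=> a b; have [U [Ux [s [t [-> ->]]]]] := germ_ex2 a b;
     rewrite -!germM amulAg.
- by move=> a b; have [U [Ux [s [t [-> ->]]]]] := germ_ex2 a b;
     rewrite -germV -!germM amulKg.
- by move=> a b; have [U [Ux [s [t [-> ->]]]]] := germ_ex2 a b;
     rewrite -germV -!germM amulgK.
Qed.
HB.instance Definition _ X F x := @stalk_axioms X F x.

Definition stalk_map_fun X (F G : presheaf X) (f : sheaf_hom F G) x
  (a : stalk F x) : stalk G x :=
  let a' := repr a in germ (f _ (pg_sec a')) (pg_in a').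

Lemma stalk_mapE X (F G : presheaf X) (f : sheaf_hom F G) (U : opens X)
    (s : F U) x (Ux : U x) :
  stalk_map_fun f (germ s Ux) = germ (f U s) Ux.
Proof.
rewrite /stalk_map_fun; have := repr_cls (germ_eq_equiv F x) (Pregerm Ux s).
rewrite -/(germ s Ux); case: (repr (germ s Ux)) => [V Vx s'] /=.
move=> [W [/= WV [WU [Wx ss]]]]; apply/germP.
by exists W, WV, WU; split=> //; rewrite -!hom_res ss.
Qed.

Lemma stalk_mapM X (F G : presheaf X) (f : sheaf_hom F G) x :
  {morph @stalk_map_fun X F G f x : a b / a * b}.
Proof.
move=> a b; have [U [Ux [s [t [-> ->]]]]] := germ_ex2 a b.
by rewrite -germM !stalk_mapE gmulfM germM.
Qed.

Definition stalk_map X (F G : presheaf X) (f : sheaf_hom F G) x :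
  {multiplicative stalk F x -> stalk G x} := bundle_hom (@stalk_mapM X F G f x).

Definition monic X (F G : presheaf X) (f : sheaf_hom F G) : Prop :=
  forall x, injective (stalk_map f x).

Definition exact_at X (F G H : presheaf X)
    (f : sheaf_hom F G) (g : sheaf_hom G H) : Prop :=
  forall x (b : stalk G x),
    stalk_map g x b = 1 <-> exists a : stalk F x, stalk_map f x a = b.

(* [Y0 F] is the sheaf of all, possibly discontinuous, sections of [F]. *)
Definition Y0_sec X (F : presheaf X) (U : opens X) : altGroupType :=
  prodg (fun u : {x : X | U x} => stalk F (sval u)).

Definition sub_pt X (U V : opens X) (VU : V `<=` U) (v : {x : X | V x}) :
  {x : X | U x} := exist _ (sval v) (VU _ (svalP v)).

Definition Y0_res_fun X (F : presheaf X) (U V : opens X) (VU : V `<=` U)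
  (s : Y0_sec F U) : Y0_sec F V := fun v => s (sub_pt VU v).

Fact Y0_resM X (F : presheaf X) (U V : opens X) (VU : V `<=` U) :
  {morph @Y0_res_fun X F U V VU : a b / a * b}.
Proof. by []. Qed.

Definition Y0_res X (F : presheaf X) (U V : opens X) (VU : V `<=` U) :
  {multiplicative Y0_sec F U -> Y0_sec F V} := bundle_hom (@Y0_resM X F U V VU).

Fact Y0_res_id X (F : presheaf X) (U : opens X) (UU : U `<=` U)
  (s : Y0_sec F U) : Y0_res F UU s = s.
Proof.
apply: functional_extensionality_dep => -[x Ux] /=; rewrite /Y0_res_fun /sub_pt /=.
by rewrite (Prop_irrelevance (UU x _) Ux).
Qed.

Fact Y0_res_comp X (F : presheaf X) (U V W : opens X)
    (VU : V `<=` U) (WV : W `<=` V) (WU : W `<=` U) (s : Y0_sec F U) :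
  Y0_res F WV (Y0_res F VU s) = Y0_res F WU s.
Proof.
apply: functional_extensionality_dep => -[x Wx] /=; rewrite /Y0_res_fun /sub_pt /=.
by rewrite (Prop_irrelevance (VU x _) (WU x (svalP (exist W x Wx)))).
Qed.

Definition Y0_presheaf X (F : presheaf X) : presheaf X :=
  Presheaf (@Y0_res_id X F) (@Y0_res_comp X F).

Fact Y0_locality X (F : presheaf X) (U : opens X) (s t : Y0_presheaf F U) :
  (forall x, U x -> exists (V : opens X) (VU : V `<=` U),
     V x /\ res VU s = res VU t) -> s = t.
Proof.
move=> st; apply: functional_extensionality_dep => -[x Ux].
have [V [VU [Vx /(congr1 (fun f : Y0_sec F V => f (exist _ x Vx)))]]] := st x Ux.
by rewrite /= /Y0_res_fun /sub_pt /= (Prop_irrelevance (VU x _) Ux).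
Qed.

Fact Y0_gluing X (F : presheaf X) (U : opens X) (I : Type) (V : I -> opens X)
    (VU : forall i, V i `<=` U) (s : forall i, Y0_presheaf F (V i)) :
  U `<=` \bigcup_i V i ->
  (forall i j (W : opens X) (Wi : W `<=` V i) (Wj : W `<=` V j),
     res Wi (s i) = res Wj (s j)) ->
  exists t : Y0_presheaf F U, forall i, res (VU i) t = s i.
Proof.
move=> UV ss.
have ix (u : {x : X | U x}) : {i | V i (sval u)}.
  by apply: cid; case: (UV _ (svalP u)) => i _ Vi; exists i.
exists (fun u => s (sval (ix u)) (exist _ (sval u) (svalP (ix u)))) => i.
apply: functional_extensionality_dep => -[x Vx]; rewrite /= /Y0_res_fun /sub_pt /=.
case: ix => j /= Vjx; pose W := capO (V j) (V i).
have := ss j i W (@capOl X _ _) (@capOr X _ _).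
move/(congr1 (fun f : Y0_sec F W => f (exist _ x (conj Vjx Vx)))).
rewrite /= /Y0_res_fun /sub_pt /= => E.
by apply: etrans (etrans _ E) _; congr (s _ (exist _ _ _));
  apply: Prop_irrelevance.
Qed.

Definition Y0 X (F : presheaf X) : sheaf X :=
  Sheaf (@Y0_locality X F) (@Y0_gluing X F).

Definition Y0_map_fun X (F G : presheaf X) (f : sheaf_hom F G) (U : opens X)
  (s : Y0 F U) : Y0 G U := fun u => stalk_map f (sval u) (s u).

Fact Y0_mapM X (F G : presheaf X) (f : sheaf_hom F G) (U : opens X) :
  {morph @Y0_map_fun X F G f U : a b / a * b}.
Proof.
by move=> a b; apply: functional_extensionality_dep => u; apply: gmulfM.
Qed.

Definition Y0_map_sec X (F G : presheaf X) (f : sheaf_hom F G) (U : opens X) :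
  {multiplicative Y0 F U -> Y0 G U} := bundle_hom (@Y0_mapM X F G f U).

Fact Y0_map_res X (F G : presheaf X) (f : sheaf_hom F G) (U V : opens X)
    (VU : V `<=` U) (s : Y0 F U) :
  Y0_map_sec f V (res VU s) = res VU (Y0_map_sec f U s).
Proof. by []. Qed.

Definition Y0_map X (F G : presheaf X) (f : sheaf_hom F G) :
  sheaf_hom (Y0 F) (Y0 G) := SheafHom (@Y0_map_res X F G f).

Definition nu_fun X (F : presheaf X) (U : opens X) (s : F U) : Y0 F U :=
  fun u => germ s (svalP u).

Fact nuM X (F : presheaf X) (U : opens X) :
  {morph @nu_fun X F U : a b / a * b}.
Proof.
by move=> a b; apply: functional_extensionality_dep => u; apply: germM.
Qed.

Definition nu_sec X (F : presheaf X) (U : opens X) :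
  {multiplicative F U -> Y0 F U} := bundle_hom (@nuM X F U).

Fact nu_res X (F : presheaf X) (U V : opens X) (VU : V `<=` U) (s : F U) :
  nu_sec F V (res VU s) = res VU (nu_sec F U s).
Proof.
by apply: functional_extensionality_dep => u; apply: germ_resE.
Qed.

Definition nu X (F : presheaf X) : sheaf_hom F (Y0 F) := SheafHom (@nu_res X F).

Lemma nu_natural X (F G : presheaf X) (f : sheaf_hom F G) (U : opens X)
    (s : F U) :
  nu G U (f U s) = Y0_map f U (nu F U s).
Proof.
by apply: functional_extensionality_dep => u; apply/esym/stalk_mapE.
Qed.

Record subsheaf (X : topologicalType) (F : sheaf X) := Subsheaf {
  sub_sec : forall U : opens X, subgroup (F U);
  sub_res : forall (U V : opens X) (VU : V `<=` U) s,
    sub_sec U s -> sub_sec V (res VU s);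
  sub_local : forall (U : opens X) s,
    (forall x, U x -> exists (V : opens X) (VU : V `<=` U),
       V x /\ sub_sec V (res VU s)) -> sub_sec U s }.

Definition ssec X (F : sheaf X) (A : subsheaf F) (U : opens X) :
  altGroupType := subgT (sub_sec A U).

Definition ssec_res_fun X (F : sheaf X) (A : subsheaf F) (U V : opens X)
  (VU : V `<=` U) (s : ssec A U) : ssec A V :=
  exist _ (res VU (sval s)) (sub_res VU (svalP s)).

Fact ssec_resM X (F : sheaf X) (A : subsheaf F) (U V : opens X)
  (VU : V `<=` U) : {morph @ssec_res_fun X F A U V VU : a b / a * b}.
Proof. by move=> a b; apply: subgT_inj; apply: gmulfM. Qed.

Definition ssec_res X (F : sheaf X) (A : subsheaf F) (U V : opens X)
  (VU : V `<=` U) : {multiplicative ssec A U -> ssec A V} :=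
  bundle_hom (@ssec_resM X F A U V VU).

Fact ssec_res_id X (F : sheaf X) (A : subsheaf F) (U : opens X)
  (UU : U `<=` U) (s : ssec A U) : ssec_res A UU s = s.
Proof. by apply: subgT_inj; apply: res_id. Qed.

Fact ssec_res_comp X (F : sheaf X) (A : subsheaf F) (U V W : opens X)
    (VU : V `<=` U) (WV : W `<=` V) (WU : W `<=` U) (s : ssec A U) :
  ssec_res A WV (ssec_res A VU s) = ssec_res A WU s.
Proof. by apply: subgT_inj; apply: res_comp. Qed.

Definition ssec_presheaf X (F : sheaf X) (A : subsheaf F) : presheaf X :=
  Presheaf (@ssec_res_id X F A) (@ssec_res_comp X F A).

Fact ssec_locality X (F : sheaf X) (A : subsheaf F) (U : opens X)
    (s t : ssec_presheaf A U) :
  (forall x, U x -> exists (V : opens X) (VU : V `<=` U),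
     V x /\ res VU s = res VU t) -> s = t.
Proof.
move=> st; apply: subgT_inj; apply: sheaf_locality => x Ux.
by have [V [VU [Vx /(congr1 sval)]]] := st x Ux; exists V, VU.
Qed.

Fact ssec_gluing X (F : sheaf X) (A : subsheaf F) (U : opens X) (I : Type)
    (V : I -> opens X) (VU : forall i, V i `<=` U)
    (s : forall i, ssec_presheaf A (V i)) :
  U `<=` \bigcup_i V i ->
  (forall i j (W : opens X) (Wi : W `<=` V i) (Wj : W `<=` V j),
     res Wi (s i) = res Wj (s j)) ->
  exists t : ssec_presheaf A U, forall i, res (VU i) t = s i.
Proof.
move=> UV ss.
have [|t tE] := sheaf_gluing VU (s := fun i => sval (s i)) UV.
  by move=> i j W Wi Wj; have /(congr1 sval) := ss i j W Wi Wj.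
suff At : sub_sec A U t by exists (exist _ t At) => i; apply: subgT_inj; apply: tE.
apply: sub_local => x Ux; have [i _ Vx] := UV x Ux.
by exists (V i), (VU i); split=> //; rewrite tE; apply: svalP.
Qed.

Definition subsheaf_sheaf X (F : sheaf X) (A : subsheaf F) : sheaf X :=
  Sheaf (@ssec_locality X F A) (@ssec_gluing X F A).

Coercion subsheaf_sheaf : subsheaf >-> sheaf.

Fact sub_incl_secM X (F : sheaf X) (A : subsheaf F) (U : opens X) :
  {morph (fun s : A U => sval s : F U) : a b / a * b}.
Proof. by []. Qed.

Definition sub_incl_sec X (F : sheaf X) (A : subsheaf F) (U : opens X) :
  {multiplicative A U -> F U} := bundle_hom (@sub_incl_secM X F A U).

Fact sub_incl_res X (F : sheaf X) (A : subsheaf F) (U V : opens X)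
  (VU : V `<=` U) (s : A U) :
  sub_incl_sec A V (res VU s) = res VU (sub_incl_sec A U s).
Proof. by []. Qed.

Definition sub_incl X (F : sheaf X) (A : subsheaf F) : sheaf_hom A F :=
  SheafHom (@sub_incl_res X F A).

Definition sub_corestr_fun X (E : presheaf X) (F : sheaf X) (A : subsheaf F)
  (f : sheaf_hom E F) (fA : forall (U : opens X) s, sub_sec A U (f U s))
  (U : opens X) (s : E U) : A U := exist _ (f U s) (fA U s).

Fact sub_corestrM X (E : presheaf X) (F : sheaf X) (A : subsheaf F)
  (f : sheaf_hom E F) (fA : forall (U : opens X) s, sub_sec A U (f U s))
  (U : opens X) : {morph sub_corestr_fun fA (U := U) : a b / a * b}.
Proof. by move=> a b; apply: subgT_inj; apply: gmulfM. Qed.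

Definition sub_corestr_sec X (E : presheaf X) (F : sheaf X) (A : subsheaf F)
  (f : sheaf_hom E F) (fA : forall (U : opens X) s, sub_sec A U (f U s))
  (U : opens X) : {multiplicative E U -> A U} :=
  bundle_hom (sub_corestrM fA (U := U)).

Fact sub_corestr_res X (E : presheaf X) (F : sheaf X) (A : subsheaf F)
  (f : sheaf_hom E F) (fA : forall (U : opens X) s, sub_sec A U (f U s))
  (U V : opens X) (VU : V `<=` U) (s : E U) :
  sub_corestr_sec fA V (res VU s) = res VU (sub_corestr_sec fA U s).
Proof. by apply: subgT_inj; apply: hom_res. Qed.

Definition sub_corestr X (E : presheaf X) (F : sheaf X) (A : subsheaf F)
  (f : sheaf_hom E F) (fA : forall (U : opens X) s, sub_sec A U (f U s)) :
  sheaf_hom E A := SheafHom (sub_corestr_res fA).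

Definition ker_sec X (F G : presheaf X) (f : sheaf_hom F G) (U : opens X) :
  subgroup (F U) := kerg (f U).

Definition ker_sheaf X (F G : sheaf X) (f : sheaf_hom F G) : subsheaf F.
Proof.
apply: (@Subsheaf _ _ (ker_sec f)) => /=.
- by move=> U V VU s fs; rewrite hom_res fs amorph1.
- move=> U s fs; apply: sheaf_locality => x /fs[V [VU [Vx /= fV]]].
  by exists V, VU; split=> //; rewrite -hom_res fV amorph1.
Defined.

(* A section of the sheaf associated with a presheaf [P] is a section of the
   disjoint union of the stalks that is locally induced by a section of [P]. *)
Definition locally_induced X (P : presheaf X) (U : opens X) :
  set (Y0 P U) :=
  [set s | forall x, U x -> exists (V : opens X) (VU : V `<=` U),
    V x /\ exists t : P V, nu P V t = res VU s].

Definition sheafify_sec X (P : presheaf X) (U : opens X) : subgroup (Y0 P U).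
Proof.
apply: (@Subgroup _ (@locally_induced X P U)).
- move=> x Ux; exists U, (@subset_refl _ _); split=> //.
  by exists 1; rewrite !amorph1.
- move=> a b Pa Pb x Ux.
  have [V [VU [Vx [s sa]]]] := Pa x Ux; have [W [WU [Wx [t tb]]]] := Pb x Ux.
  have VWU : capO V W `<=` U := subset_trans (@capOl _ V W) VU.
  exists (capO V W), VWU; split=> //.
  exists (res (@capOl _ V W) s * res (@capOr _ V W) t).
  rewrite !gmulfM !hom_res sa tb.
  by rewrite (res_comp VU (@capOl _ V W) VWU) (res_comp WU (@capOr _ V W) VWU).
- move=> a Pa x Ux; have [V [VU [Vx [s sa]]]] := Pa x Ux.
  by exists V, VU; split=> //; exists s^-1; rewrite !amorphV sa.
Defined.

Definition sheafify X (P : presheaf X) : subsheaf (Y0 P).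
Proof.
apply: (@Subsheaf _ _ (@sheafify_sec X P)).
- move=> U V VU s Ps x Vx; have [W [WU [Wx [t ts]]]] := Ps x (VU x Vx).
  have VWU : capO V W `<=` U := subset_trans (@capOl _ V W) VU.
  exists (capO V W), (@capOl _ V W); split=> //.
  exists (res (@capOr _ V W) t); rewrite hom_res ts.
  by rewrite (res_comp WU (@capOr _ V W) VWU) (res_comp VU (@capOl _ V W) VWU).
- move=> U s Ps x Ux; have [V [VU [Vx PV]]] := Ps x Ux.
  have [W [WV [Wx [t ts]]]] := PV x Vx.
  exists W, (subset_trans WV VU); split=> //; exists t.
  by rewrite ts (res_comp VU WV (subset_trans WV VU)).
Defined.

Fact nu_induced X (P : presheaf X) (U : opens X) (s : P U) :
  sub_sec (sheafify P) U (nu P U s).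
Proof.
move=> x Ux; exists U, (@subset_refl _ _); split=> //.
by exists s; rewrite res_id.
Qed.

Definition sheafify_unit X (P : presheaf X) : sheaf_hom P (sheafify P) :=
  sub_corestr (@nu_induced X P).

Fact sheafify_map_induced X (P Q : presheaf X) (f : sheaf_hom P Q)
    (U : opens X) (s : sheafify P U) :
  sub_sec (sheafify Q) U (hom_comp (Y0_map f) (sub_incl (sheafify P)) U s).
Proof.
move=> x Ux; have [V [VU [Vx [t ts]]]] := svalP s x Ux.
exists V, VU; split=> //; exists (f V t).
by rewrite nu_natural ts -hom_res.
Qed.

Definition sheafify_map X (P Q : presheaf X) (f : sheaf_hom P Q) :
  sheaf_hom (sheafify P) (sheafify Q) :=
  sub_corestr (@sheafify_map_induced X P Q f).

Definition quotg_hom (G H : altGroupType) (N : set G) (M : set H)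
  (f : {multiplicative G -> H}) (fNM : forall n, N n -> M (f n)) :
  {multiplicative quotg N -> quotg M} := bundle_hom (quotg_mapM fNM).

Definition coker_sec X (F G : presheaf X) (f : sheaf_hom F G) (U : opens X) :
  altGroupType := quotg (range (f U)).

Fact coker_range X (F G : presheaf X) (f : sheaf_hom F G) (U V : opens X)
  (VU : V `<=` U) t : range (f U) t -> range (f V) (res VU t).
Proof. by move=> [s _ <-]; exists (res VU s) => //; apply: hom_res. Qed.

Definition coker_res X (F G : presheaf X) (f : sheaf_hom F G) (U V : opens X)
  (VU : V `<=` U) : {multiplicative coker_sec f U -> coker_sec f V} :=
  quotg_hom (@coker_range X F G f U V VU).

Lemma coker_resE X (F G : presheaf X) (f : sheaf_hom F G) (U V : opens X)
    (VU : V `<=` U) (t : G U) :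
  coker_res f VU (qproj (range (f U)) t) = qproj (range (f V)) (res VU t).
Proof. exact: quotg_mapE (@coker_range X F G f U V VU) t. Qed.

Fact coker_res_id X (F G : presheaf X) (f : sheaf_hom F G) (U : opens X)
  (UU : U `<=` U) (s : coker_sec f U) : coker_res f UU s = s.
Proof. by rewrite -(qproj_repr s) coker_resE res_id. Qed.

Fact coker_res_comp X (F G : presheaf X) (f : sheaf_hom F G) (U V W : opens X)
    (VU : V `<=` U) (WV : W `<=` V) (WU : W `<=` U) (s : coker_sec f U) :
  coker_res f WV (coker_res f VU s) = coker_res f WU s.
Proof. by rewrite -(qproj_repr s) !coker_resE (res_comp VU WV WU). Qed.

Definition coker_presheaf X (F G : presheaf X) (f : sheaf_hom F G) :
  presheaf X := Presheaf (@coker_res_id X F G f) (@coker_res_comp X F G f).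

Definition coker_sheaf X (F G : presheaf X) (f : sheaf_hom F G) : sheaf X :=
  sheafify (coker_presheaf f).

Definition qproj_sec X (F G : presheaf X) (f : sheaf_hom F G) (U : opens X) :
  {multiplicative G U -> coker_presheaf f U} := qproj (range (f U)).

Fact qproj_res X (F G : presheaf X) (f : sheaf_hom F G) (U V : opens X)
    (VU : V `<=` U) (t : G U) :
  qproj_sec f V (res VU t) = res VU (qproj_sec f U t).
Proof. exact/esym/coker_resE. Qed.

Definition coker_proj X (F G : presheaf X) (f : sheaf_hom F G) :
  sheaf_hom G (coker_sheaf f) :=
  hom_comp (sheafify_unit _) (SheafHom (@qproj_res X F G f)).

Lemma coker_proj1 X (F G : presheaf X) (f : sheaf_hom F G) (U : opens X)
  (s : F U) : coker_proj f U (f U s) = 1.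
Proof.
rewrite /= -[RHS](amorph1 (sheafify_unit (coker_presheaf f) U)).
congr (sheafify_unit _ _ _); apply/(qprojP (range (f U)) (f U s) 1).
by apply: gencong_gen; exists s.
Qed.

Fact coker_map_range X (F G F' G' : presheaf X) (f : sheaf_hom F G)
    (f' : sheaf_hom F' G') (a : sheaf_hom F F') (b : sheaf_hom G G')
    (ab : forall (U : opens X) s, f' U (a U s) = b U (f U s)) (U : opens X) t :
  range (f U) t -> range (f' U) (b U t).
Proof. by move=> [s _ <-]; exists (a U s). Qed.

Definition coker_map_sec X (F G F' G' : presheaf X) (f : sheaf_hom F G)
    (f' : sheaf_hom F' G') (a : sheaf_hom F F') (b : sheaf_hom G G')
    (ab : forall (U : opens X) s, f' U (a U s) = b U (f U s)) (U : opens X) :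
  {multiplicative coker_presheaf f U -> coker_presheaf f' U} :=
  quotg_hom (coker_map_range ab (U := U)).

Fact coker_map_res X (F G F' G' : presheaf X) (f : sheaf_hom F G)
    (f' : sheaf_hom F' G') (a : sheaf_hom F F') (b : sheaf_hom G G')
    (ab : forall (U : opens X) s, f' U (a U s) = b U (f U s))
    (U V : opens X) (VU : V `<=` U) (s : coker_presheaf f U) :
  coker_map_sec ab V (res VU s) = res VU (coker_map_sec ab U s).
Proof.
rewrite -(qproj_repr s); move: (repr s) => {}s.
have E (W : opens X) (t : G W) :
    coker_map_sec ab W (qproj (range (f W)) t) = qproj (range (f' W)) (b W t).
  exact: quotg_mapE (coker_map_range ab (U := W)) t.
transitivity (coker_map_sec ab V (qproj (range (f V)) (res VU s))).
  by congr (coker_map_sec ab V _); apply: coker_resE.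
by rewrite !E hom_res; apply/esym/coker_resE.
Qed.

Definition coker_map X (F G F' G' : presheaf X) (f : sheaf_hom F G)
    (f' : sheaf_hom F' G') (a : sheaf_hom F F') (b : sheaf_hom G G')
    (ab : forall (U : opens X) s, f' U (a U s) = b U (f U s)) :
  sheaf_hom (coker_sheaf f) (coker_sheaf f') :=
  sheafify_map (SheafHom (coker_map_res ab)).

Record diff_sheaf (X : topologicalType) := DiffSheaf {
  term :> nat -> sheaf X;
  differential : forall m, sheaf_hom (term m) (term m.+1);
  diff_diff : forall m (U : opens X) s, differential m.+1 U (differential m U s) = 1 }.

Definition resolvent X (B : sheaf X) (L : diff_sheaf X)
    (eps : sheaf_hom B (L 0)) : Prop :=
  [/\ monic eps, exact_at eps (differential L 0) &
      forall m, exact_at (differential L m) (differential L m.+1)].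

Definition Z1 X (B : sheaf X) : sheaf X := coker_sheaf (nu B).

Definition Z1_map X (A B : sheaf X) (f : sheaf_hom A B) :
  sheaf_hom (Z1 A) (Z1 B) := coker_map (nu_natural f).

Fixpoint Zc X (B : sheaf X) (m : nat) : sheaf X :=
  if m is m'.+1 then Z1 (Zc B m') else B.

Fixpoint Zc_map X (A B : sheaf X) (f : sheaf_hom A B) (m : nat) :
    sheaf_hom (Zc A m) (Zc B m) :=
  if m is m'.+1 then Z1_map (Zc_map f m') else f.

Definition Yc X (B : sheaf X) (m : nat) : sheaf X := Y0 (Zc B m).

Definition Yc_map X (A B : sheaf X) (f : sheaf_hom A B) (m : nat) :
  sheaf_hom (Yc A m) (Yc B m) := Y0_map (Zc_map f m).

Definition Yc_diff X (B : sheaf X) (m : nat) :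
  sheaf_hom (Yc B m) (Yc B m.+1) :=
  hom_comp (nu (Zc B m.+1)) (coker_proj (nu (Zc B m))).

Fact Yc_diff_diff X (B : sheaf X) (m : nat) (U : opens X) (s : Yc B m U) :
  Yc_diff B m.+1 U (Yc_diff B m U s) = 1.
Proof.
transitivity (nu (Zc B m.+2) U 1); last exact: amorph1.
congr (nu (Zc B m.+2) U _).
exact: coker_proj1 (nu (Zc B m.+1)) U (coker_proj (nu (Zc B m)) U s).
Qed.

Definition canonical X (B : sheaf X) : diff_sheaf X :=
  DiffSheaf (@Yc_diff_diff X B).

Record supports (X : topologicalType) := Supports {
  supp_mem :> set (set X);
  supp_closed : forall A, supp_mem A -> closed A;
  supp_sub : forall A B, supp_mem B -> closed A -> A `<=` B -> supp_mem A;
  supp0 : supp_mem set0;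
  suppU : forall A B, supp_mem A -> supp_mem B -> supp_mem (A `|` B) }.

Definition support X (F : presheaf X) (s : F (fullO X)) : set X :=
  [set x | germ s (I : fullO X x) <> 1].

Lemma support_closed X (F : presheaf X) (s : F (fullO X)) :
  closed (support s).
Proof.
rewrite -openC openE => x /= nx; have {nx} := contrapT nx.
rewrite -(germ1 F (I : fullO X x)) => /germP[W [W1 [W2 [Wx sW]]]].
apply: (filterS (P := W)); last exact: open_nbhs_nbhs (conj (open_setP W) Wx).
move=> y Wy; apply => /=; rewrite -(germ1 F (I : fullO X y)).
by apply/germP; exists W, W1, W2.
Qed.

Definition Gamma_sub X (phi : supports X) (F : presheaf X) :
  subgroup (F (fullO X)).
Proof.
apply: (@Subgroup _ [set s | phi (support s)]) => /=.
- apply: (supp_sub (supp0 phi) (@support_closed _ F _)) => x.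
  by rewrite /support /= germ1.
- move=> a b pa pb; apply: (supp_sub (suppU pa pb) (@support_closed _ F _)) => x.
  rewrite /support /= germM => ab; apply: contrapT => /not_orP[].
  by move=> /contrapT ea /contrapT eb; apply: ab; rewrite ea eb amul1g.
- move=> a pa; apply: (supp_sub pa (@support_closed _ F _)) => x.
  by rewrite /support /= germV => + ea; rewrite ea ainv1.
Defined.

Definition Gamma X (phi : supports X) (F : presheaf X) : altGroupType :=
  subgT (Gamma_sub phi F).

Fact Gamma_map_subproof X (phi : supports X) (F G : presheaf X)
    (f : sheaf_hom F G) (s : Gamma phi F) :
  Gamma_sub phi G (f (fullO X) (sval s)).
Proof.
apply: (supp_sub (svalP s) (@support_closed _ G _)) => x.
rewrite /support /= => + es; rewrite -stalk_mapE.
by rewrite -[stalk_map_fun _ _]/(stalk_map f x _) es amorph1.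
Qed.

Definition Gamma_map_fun X (phi : supports X) (F G : presheaf X)
  (f : sheaf_hom F G) (s : Gamma phi F) : Gamma phi G :=
  exist _ (f (fullO X) (sval s)) (Gamma_map_subproof f s).

Fact Gamma_mapM X (phi : supports X) (F G : presheaf X) (f : sheaf_hom F G) :
  {morph @Gamma_map_fun X phi F G f : a b / a * b}.
Proof. by move=> a b; apply: subgT_inj; apply: gmulfM. Qed.

Definition Gamma_map X (phi : supports X) (F G : presheaf X)
  (f : sheaf_hom F G) : {multiplicative Gamma phi F -> Gamma phi G} :=
  bundle_hom (@Gamma_mapM X phi F G f).

Definition cocycle X (phi : supports X) (L : diff_sheaf X) (m : nat) :
  altGroupType := subgT (kerg (Gamma_map phi (differential L m))).

Definition coboundary X (phi : supports X) (L : diff_sheaf X) (m : nat) :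
    set (cocycle phi L m) :=
  match m with
  | 0 => [set 1]
  | m'.+1 => [set z | exists c, Gamma_map phi (differential L m') c = sval z]
  end.

Definition coh X (phi : supports X) (L : diff_sheaf X) (m : nat) :
  altGroupType := quotg (@coboundary X phi L m).

Definition coh_class X (phi : supports X) (L : diff_sheaf X) (m : nat)
  (z : cocycle phi L m) : coh phi L m := qproj (@coboundary X phi L m) z.

(* [H^m_phi (X; B)] *)
Definition sheaf_coh X (phi : supports X) (B : sheaf X) (m : nat) : altGroupType :=
  coh phi (canonical B) m.

Definition acyclic X (phi : supports X) (F : sheaf X) : Prop :=
  forall b, (0 < b)%N -> forall h : sheaf_coh phi F b, h = 1.

(* [cyc eps b] is [Ker (L b -> L b.+1)], with [cyc eps 0 = B]. *)
Definition cyc X (B : sheaf X) (L : diff_sheaf X) (eps : sheaf_hom B (L 0))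
    (b : nat) : sheaf X :=
  if b is b'.+1 then ker_sheaf (differential L b'.+1) else B.

Definition cyc_in X (B : sheaf X) (L : diff_sheaf X) (eps : sheaf_hom B (L 0))
    (b : nat) : sheaf_hom (cyc eps b) (L b) :=
  match b with
  | 0 => eps
  | b'.+1 => sub_incl (ker_sheaf (differential L b'.+1))
  end.

Definition cyc_out X (B : sheaf X) (L : diff_sheaf X) (eps : sheaf_hom B (L 0))
  (b : nat) : sheaf_hom (L b) (cyc eps b.+1) :=
  sub_corestr (A := ker_sheaf (differential L b.+1)) (@diff_diff X L b).

(* The connecting homomorphism [H^v(C) -> H^v.+1(A)] of a short exact sequence
   [e -> A -> B -> C -> e], as the relation defined by the snake
   [C <- B -> B <- A] on the canonical resolvents. *)
Definition connecting X (phi : supports X) (A B C : sheaf X)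
    (f : sheaf_hom A B) (g : sheaf_hom B C) (v : nat)
    (h : sheaf_coh phi C v) (k : sheaf_coh phi A v.+1) : Prop :=
  exists (c : cocycle phi (canonical C) v) (b : Gamma phi (Yc B v))
         (a : cocycle phi (canonical A) v.+1),
    [/\ coh_class c = h,
        Gamma_map phi (Yc_map g v) b = sval c,
        Gamma_map phi (Yc_map f v.+1) (sval a) = Gamma_map phi (Yc_diff B v) b &
        coh_class a = k].

(* The composition of the connecting homomorphisms
   [H^v(cyc i) -> H^(v+1)(cyc (i-1)) -> ... -> H^n(cyc 0)], where [n = v + i]. *)
Fixpoint connecting_chain X (phi : supports X) (B : sheaf X) (L : diff_sheaf X)
    (eps : sheaf_hom B (L 0)) (n i v : nat) :
    sheaf_coh phi (cyc eps i) v -> sheaf_coh phi B n -> Prop :=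
  match i return sheaf_coh phi (cyc eps i) v -> sheaf_coh phi B n -> Prop with
  | 0 => fun h k => exists vn : v = n, ecast m (sheaf_coh phi B m) vn h = k
  | i'.+1 => fun h k => exists h' : sheaf_coh phi (cyc eps i') v.+1,
      connecting (cyc_in eps i') (cyc_out eps i') h h' /\
      connecting_chain h' k
  end.

(* [Gamma_phi(F) -> H^0_phi(X; F)], as a relation. *)
Definition H0_of X (phi : supports X) (F : sheaf X) (s : Gamma phi F)
    (h : sheaf_coh phi F 0) : Prop :=
  exists z : cocycle phi (canonical F) 0,
    sval z = Gamma_map phi (nu F) s /\ coh_class z = h.

(* [kappa], as a relation: a class in [H^b (Gamma_phi L)] is represented by a
   section of [cyc eps b], which is mapped along the connecting homomorphisms;
   the first of them starts from [H^0_phi(X; cyc eps b)]. *)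
Definition kappa X (phi : supports X) (B : sheaf X) (L : diff_sheaf X)
    (eps : sheaf_hom B (L 0)) (b : nat)
    (h : coh phi L b) (k : sheaf_coh phi B b) : Prop :=
  exists (z : cocycle phi L b) (s : Gamma phi (cyc eps b))
         (h0 : sheaf_coh phi (cyc eps b) 0),
    [/\ coh_class z = h, Gamma_map phi (cyc_in eps b) s = sval z,
        H0_of s h0 & connecting_chain h0 k].

Arguments kappa {X} phi {B L} eps b h k.

Definition isomorphism (G H : altGroupType) (k : G -> H -> Prop) : Prop :=
  exists f : {multiplicative G -> H},
    bijective f /\ forall g h, k g h <-> f g = h.

Definition commutative_sheaf X (F : sheaf X) : Prop :=
  forall U : opens X, commutative_group (F U).

(* The product [i_l i_s = +/- i_k] of standard generators of the Cayley-Dickson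
   algebra of dimension [2 ^ r]; the boolean is true when the sign is [-].
   The doubling is [(a + b i)(c + d i) = (a c - d^* b) + (d a + b c^* ) i] with
   [i] the generator of index [2 ^ (r - 1)]. *)
Fixpoint cd_mul (r l s : nat) : bool * nat :=
  if r is r'.+1 then
    let n := (2 ^ r')%N in
    if (l < n)%N then
      if (s < n)%N then cd_mul r' l s
      else let: (e, k) := cd_mul r' (s - n) l in (e, n + k)%N
    else
      if (s < n)%N then
        let: (e, k) := cd_mul r' (l - n) s in (e (+) (s != 0), n + k)%N
      else let: (e, k) := cd_mul r' (s - n) (l - n) in (e (+) (s == n), k)
  else (false, 0%N).

(* The ring [R i_0 + ... + R i_(2^r - 1)]; the pairwise isomorphic rings of
   coefficients are identified with one commutative ring [R]. *)
Definition hat (r : nat) (R : comPzRingType) : Type := 'I_(2 ^ r) -> R.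

Definition hat_mul (r : nat) (R : comPzRingType) (y z : hat r R) : hat r R :=
  fun k => (\sum_(l < 2 ^ r) \sum_(s < 2 ^ r | (cd_mul r l s).2 == k)
              (-1) ^+ (cd_mul r l s).1 * (y l * z s))%R.

Definition hat_one (r : nat) (R : comPzRingType) : hat r R :=
  fun k => ((val k == 0%N)%:R)%R.

Record twisted_group (r : nat) (G : altGroupType) := TwistedGroup {
  tw_ring : comPzRingType;
  tw_coord : G -> hat r tw_ring;
  tw_coord_inj : injective tw_coord;
  tw_coordM : forall g f, tw_coord (g * f) = hat_mul (tw_coord g) (tw_coord f);
  tw_coord1 : tw_coord 1 = @hat_one r tw_ring;
  tw_coord_unit : forall y : hat r tw_ring,
    (exists z, hat_mul y z = @hat_one r tw_ring /\
               hat_mul z y = @hat_one r tw_ring) ->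
    exists g, tw_coord g = y;
  tw_conj : G -> G;
  tw_conj_bij : bijective tw_conj;
  tw_conjM : forall g f, tw_conj (g * f) = tw_conj f * tw_conj g;
  tw_conj1 : tw_conj 1 = 1 }.

Definition tw_component r G (t : twisted_group r G) (k : 'I_(2 ^ r)) : set G :=
  [set g | forall j, j != k -> tw_coord t g j = 0%R].

Definition twisted_sheaf (r : nat) X (F : sheaf X) : Type :=
  forall U : opens X, twisted_group r (F U).

Definition automorphism X (F : sheaf X) (f : sheaf_hom F F) : Prop :=
  forall U : opens X, bijective (f U).

Definition twisted_diff_sheaf (r : nat) X (L : diff_sheaf X) : Prop :=
  exists (t : forall m, twisted_sheaf r (L m))
         (theta : forall m, sheaf_hom (L m) (L m)),
    (forall m, automorphism (theta m)) /\
    forall m (k : 'I_(2 ^ r)) (U : opens X) (s : L m U),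
      tw_component (t m U) k s ->
      tw_component (t m.+1 U) k (theta m.+1 U (differential L m U s)).

(* Without commutativity the cokernels in the construction of the canonical
   resolvent are quotients by the least congruence, and neither the exactness
   of [e -> F -> Y^0 -> Y^1 -> ...] nor the normality of the coboundaries among
   the cocycles is automatic.  Both hold when [F] is commutative. *)
Definition canonical_cohomology X (phi : supports X) (F : sheaf X) : Prop :=
  resolvent (L := canonical F) (nu F) /\
  forall m, normal_set (@coboundary X phi (canonical F) m).

Definition commutative_case X (B : sheaf X) (L : diff_sheaf X) : Prop :=
  commutative_sheaf B /\ forall m, commutative_sheaf (L m).

Definition twisted_case X (phi : supports X) (B : sheaf X) (L : diff_sheaf X)
    (eps : sheaf_hom B (L 0)) : Prop :=
  exists r : nat,
    [/\ (0 < r)%N,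
        commutative_sheaf B \/ inhabited (twisted_sheaf r B),
        twisted_diff_sheaf r L &
        forall m, canonical_cohomology phi (L m) /\
                  canonical_cohomology phi (cyc eps m)].

(* Main.v *)
(* Homomorphisms of the alternative groups considered here are determined by
   their kernels, since [(f * g^-1) * g = f]; this is all the group theory that
   the nine lemma and the long exact sequence need.  Each short exact sequence
   [cyc m -> L m -> cyc m.+1] gives short exact sequences of canonical
   resolvents, exact on sections with supports because [Y0] admits discontinuous
   lifts.  As [L m] is acyclic, the connecting maps are bijective in positive
   degrees, and in degree 0 the connecting map is surjective with kernel the
   image of [Gamma (L m)]. *)

From mathcomp Require Import all_boot all_algebra.
From mathcomp Require Import boolp classical_sets topology.
Require Import Defs.

Set Implicit Arguments.
Unset Strict Implicit.
Unset Printing Implicit Defensive.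

Local Open Scope classical_set_scope.
Local Open Scope group_scope.

(** * Alternative groups, kernels and generated congruences *)

Lemma ainvK (G : altGroupType) (g : G) : g^-1^-1 = g.
Proof. by apply/esym/amul_inv_uniq; rewrite amulVg. Qed.

Lemma amulgVK (G : altGroupType) (f g : G) : (f * g^-1) * g = f.
Proof. by rewrite -{2}(ainvK g) amulgK. Qed.

Lemma amulV_eq1 (G : altGroupType) (g f : G) : g * f^-1 = 1 -> g = f.
Proof. by move=> gf; rewrite -(amulgVK g f) gf amul1g. Qed.

(** If [f a = f b] then [a * b^-1] lies in the kernel, and [(a * b^-1) * b = a] recovers [a] without
    associativity. *)
Lemma amorph_inj (G H : altGroupType) (f : {multiplicative G -> H}) :
  (forall a, f a = 1 -> a = 1) -> injective f.
Proof.
move=> f1 a b fab; apply/amulV_eq1/f1.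
by rewrite gmulfM amorphV fab amulgV.
Qed.

Lemma gencong_morph (G H : altGroupType) (N : set G)
    (f : {multiplicative G -> H}) :
  (forall n, N n -> f n = 1) -> forall a b, gencong N a b -> f a = f b.
Proof.
move=> fN a b /(_ (fun x y => f x = f y)); apply=> [|n /fN ->]; last by rewrite amorph1.
split; first by split=> // [x y z -> ->].
- by move=> x x' y y' fx fy; rewrite !gmulfM fx fy.
- by move=> x x' fx; rewrite !amorphV fx.
Qed.

(** Multiply [a * b^-1 ~ 1] on the right by [b]. The converse is what normality of [N] provides. *)
Lemma gencong_div (G : altGroupType) (N : set G) a b :
  N (a * b^-1) -> gencong N a b.
Proof.
move=> /gencong_gen ab; rewrite -(amulgVK a b) -[X in gencong N _ X](amul1g b).
have [eN M _] := gencongP N.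
exact: M ab (eqv_refl eN b).
Qed.

Lemma normal_setP (G : altGroupType) (N : set G) a b :
  normal_set N -> qproj N a = qproj N b <-> N (a * b^-1).
Proof.
move=> nN; split=> [ab|]; last by move=> abN; apply/(qprojP N a b); apply: gencong_div.
by apply/nN; rewrite qprojM -qprojV ab amulgV.
Qed.

(** The relation [N (a * b^-1)] is itself a congruence here, so the least congruence lies inside it
    and the class of 1 does not outgrow [N]. *)
Lemma commutative_normal (G : altGroupType) (N : subgroup G) :
  commutative_group G -> normal_set N.
Proof.
move=> [cG aG] a; split=> [/(qprojP N a 1)|Na]; last first.
  by apply/(qprojP N a 1); apply: gencong_gen.
move=> /(_ (fun a b => N (a * b^-1))) aN.
suff: N (a * 1^-1) by rewrite ainv1 amulg1.
apply: aN; last first.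
  by move=> n; rewrite ainv1 amulg1.
have inv_mul (x y : G) : (x * y)^-1 = x^-1 * y^-1.
  apply/esym/amul_inv_uniq; rewrite (cG x) aG -(aG y) amulgV amulg1.
  exact: amulgV.
split; first split.
- by move=> x; rewrite amulgV; apply: subgroup1.
- by move=> x y /subgroupV; rewrite inv_mul ainvK cG.
- move=> x y z xy /(subgroupM xy).
  by rewrite aG amulgVK.
- move=> x x' y y' /subgroupM xx /xx; rewrite inv_mul.
  by rewrite -!aG [x'^-1 * (y * _)]aG (cG _ y) -aG.
- by move=> x x' /subgroupV; rewrite inv_mul.
Qed.

(** * Germs, and exactness on stalks versus sections *)

Lemma stalk_mapG X (F G : presheaf X) (f : sheaf_hom F G) (U : opens X)
    (s : F U) x (Ux : U x) :
  stalk_map f x (germ s Ux) = germ (f U s) Ux.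
Proof. exact: stalk_mapE. Qed.

Lemma germ_eq1 X (F : presheaf X) (U : opens X) (s : F U) x (Ux : U x) :
  germ s Ux = 1 <->
  exists (W : opens X) (WU : W `<=` U), W x /\ res WU s = 1.
Proof.
rewrite -(germ1 F Ux); split=> [/germP[W [WU [WU' [Wx sW]]]]|[W [WU [Wx sW]]]].
  by exists W, WU; rewrite sW amorph1.
by apply/germP; exists W, WU, WU; rewrite sW amorph1.
Qed.

Lemma germ_inj X (F : sheaf X) (U : opens X) (s t : F U) :
  (forall x (Ux : U x), germ s Ux = germ t Ux) -> s = t.
Proof.
move=> st; apply: sheaf_locality => x Ux.
have /germP[W [WU [WU' [Wx sW]]]] := st x Ux.
by exists W, WU; split=> //; rewrite sW (Prop_irrelevance WU' WU).
Qed.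

Lemma monic_sec X (F : sheaf X) (G : presheaf X) (f : sheaf_hom F G) :
  monic f -> forall U : opens X, injective (f U).
Proof.
move=> mf U s t fst; apply: germ_inj => x Ux; apply: mf.
by rewrite !stalk_mapG fst.
Qed.

Lemma sec_monic X (F G : presheaf X) (f : sheaf_hom F G) :
  (forall U : opens X, injective (f U)) -> monic f.
Proof.
move=> jf x a b; have [U [Ux [s [t [-> ->]]]]] := germ_ex2 a b.
rewrite !stalk_mapG => /germP[W [WU [WU' [Wx]]]].
rewrite -!hom_res => /jf sW; apply/germP.
by exists W, WU, WU'.
Qed.

Lemma sec_exact X (A B C : presheaf X) (f : sheaf_hom A B) (g : sheaf_hom B C) :
  (forall (U : opens X) s, g U s = 1 <-> exists a, f U a = s) -> exact_at f g.
Proof.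
move=> fg x b; split=> [|[a <-]].
  have [U [Ux [s ->]]] := germ_ex b.
  rewrite stalk_mapG => /germ_eq1[W [WU [Wx]]].
  rewrite -hom_res => /fg[a fa]; exists (germ a Wx).
  by rewrite stalk_mapG fa germ_resE.
have [U [Ux [s ->]]] := germ_ex a; rewrite !stalk_mapG.
have /fg -> : exists a, f U a = f U s by exists s.
exact: germ1.
Qed.

Lemma exact_comp1 X (A B : presheaf X) (C : sheaf X) (f : sheaf_hom A B)
    (g : sheaf_hom B C) :
  exact_at f g -> forall (U : opens X) s, g U (f U s) = 1.
Proof.
move=> fg U s; apply: germ_inj => x Ux; rewrite germ1 -!stalk_mapG.
by apply/fg; exists (germ s Ux).
Qed.

(** Left exactness of the section functor: stalkwise preimages spread to local ones, which are
    unique because [f] is monic and therefore glue. *)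
Lemma exact_sec X (A B : sheaf X) (C : presheaf X) (f : sheaf_hom A B)
    (g : sheaf_hom B C) :
  monic f -> exact_at f g ->
  forall (U : opens X) s, g U s = 1 -> exists a, f U a = s.
Proof.
move=> mf fg U s gs.
have lift (u : {x : X | U x}) : exists V : opens X, exists VU : V `<=` U,
    V (sval u) /\ exists a, f V a = res VU s.
  case: u => x Ux /=.
  have [a fa] : exists a, stalk_map f x a = germ s Ux.
    by apply/fg; rewrite stalk_mapG gs germ1.
  have [V [Vx [t ta]]] := germ_ex a; move: fa; rewrite ta stalk_mapG.
  move=> /germP[W [WV [WU [Wx tW]]]]; exists W, WU; split=> //.
  by exists (res WV t); rewrite hom_res.
pose V u := sval (cid (lift u)); pose VU u := sval (cid (svalP (cid (lift u)))).
have VP u : V u (sval u) /\ exists a, f (V u) a = res (VU u) s.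
  exact: svalP (cid (svalP (cid (lift u)))).
pose a u := sval (cid (VP u).2).
have aP u : f (V u) (a u) = res (VU u) s := svalP (cid (VP u).2).
have [||t tP] := sheaf_gluing VU (s := a).
- by move=> x Ux; exists (exist _ x Ux) => //; apply: (VP (exist _ x Ux)).1.
(* On overlaps both local preimages map to the restriction of [s], so injectivity of [f] on sections
   makes them agree. *)
- move=> i j W Wi Wj; apply: (monic_sec mf); rewrite !hom_res !aP.
  by rewrite !(res_comp _ _ (subset_trans Wi (VU i))).
exists t; apply: sheaf_locality => x Ux; exists (V (exist _ x Ux)), (VU (exist _ x Ux)).
by split; [apply: (VP (exist _ x Ux)).1 | rewrite -hom_res tP aP].
Qed.

(** * Sections with supports *)

Lemma support_monic X (F G : presheaf X) (f : sheaf_hom F G) s :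
  monic f -> support s `<=` support (f (fullO X) s).
Proof.
move=> mf x /= sx fsx; apply/sx/mf.
by rewrite stalk_mapG amorph1.
Qed.

Lemma Gamma_monic X (phi : supports X) (F : sheaf X) (G : presheaf X)
    (f : sheaf_hom F G) : monic f -> injective (Gamma_map phi f).
Proof.
by move=> mf s t /(congr1 sval) /(monic_sec mf) st; apply: subgT_inj.
Qed.

Lemma Gamma_comp1 X (phi : supports X) (A B : presheaf X) (C : sheaf X)
    (f : sheaf_hom A B) (g : sheaf_hom B C) :
  exact_at f g -> forall s, Gamma_map phi g (Gamma_map phi f s) = 1.
Proof. by move=> fg s; apply: subgT_inj; apply: (exact_comp1 fg). Qed.

(** A monic [f] does not shrink supports, so the preimage of a section with support in [phi] again
    has support in [phi]. *)
Lemma Gamma_exact X (phi : supports X) (A B : sheaf X) (C : presheaf X)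
    (f : sheaf_hom A B) (g : sheaf_hom B C) :
  monic f -> exact_at f g ->
  forall s, Gamma_map phi g s = 1 -> exists a, Gamma_map phi f a = s.
Proof.
move=> mf fg s /(congr1 sval) /(exact_sec mf fg)[a fa].
suff pa : Gamma_sub phi A a by exists (exist _ a pa); apply: subgT_inj.
apply: (supp_sub (svalP s) (@support_closed _ A _)).
by rewrite -fa; apply: support_monic.
Qed.

(** * Exactness of [Y0] and of the cokernel sheaf *)

Lemma nu_monic X (F : presheaf X) : monic (nu F).
Proof.
move=> x a b; have [U [Ux [s [t [-> ->]]]]] := germ_ex2 a b.
rewrite !stalk_mapG => /germP[W [WU [WU' [Wx]]]].
(* Evaluating at [x] a discontinuous section that comes from [F] returns its germ at [x]. *)
rewrite -!hom_res => /(congr1 (fun p : Y0 F W => p (exist _ x Wx))).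
by rewrite /= /nu_fun !(germ_resE _ _ Ux).
Qed.

Definition short_exact X (A B C : presheaf X) (f : sheaf_hom A B)
    (g : sheaf_hom B C) : Prop :=
  [/\ monic f, exact_at f g & forall x c, exists b, stalk_map g x b = c].

Lemma Y0_monic X (F G : presheaf X) (f : sheaf_hom F G) :
  monic f -> monic (Y0_map f).
Proof.
move=> mf; apply: sec_monic => U s t fst.
apply: functional_extensionality_dep => u; apply: mf.
exact: (congr1 (fun p : Y0 G U => p u) fst).
Qed.

Lemma Y0_exact X (A B C : presheaf X) (f : sheaf_hom A B) (g : sheaf_hom B C) :
  exact_at f g -> exact_at (Y0_map f) (Y0_map g).
Proof.
move=> fg; apply: sec_exact => U s; split=> [gs|[a <-]].
  have lift (u : {x : X | U x}) : exists a, stalk_map f (sval u) a = s u.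
    by apply/fg; apply: (congr1 (fun p : Y0 C U => p u) gs).
  exists (fun u => sval (cid (lift u))).
  by apply: functional_extensionality_dep => u; apply: svalP (cid (lift u)).
apply: functional_extensionality_dep => u; apply/fg.
by exists (a u).
Qed.

(** Lifts are chosen independently at each point, as discontinuous sections permit; taking the lift
    1 wherever [s] is 1 keeps the support inside that of [s]. *)
Lemma Gamma_Y0_epi X (phi : supports X) (B C : presheaf X) (g : sheaf_hom B C) :
  (forall x c, exists b, stalk_map g x b = c) ->
  forall s, exists t, Gamma_map phi (Y0_map g) t = s.
Proof.
move=> epi_g [s ps].
have lift (u : {x : X | fullO X x}) : exists b, stalk_map g (sval u) b = s u /\
    (s u = 1 -> b = 1).
  have [su|su] := pselect (s u = 1); first by exists 1; rewrite amorph1 su.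
  by have [b gb] := epi_g _ (s u); exists b.
pose t : Y0 B (fullO X) := fun u => sval (cid (lift u)).
have tP u : stalk_map g (sval u) (t u) = s u /\ (s u = 1 -> t u = 1).
  exact: svalP (cid (lift u)).
suff pt : Gamma_sub phi (Y0 B) t.
  exists (exist _ t pt); apply: subgT_inj.
  by apply: functional_extensionality_dep => u; case: (tP u).
apply: (supp_sub ps (@support_closed _ (Y0 B) _)) => x /=.
rewrite /support /= => + sx; apply; apply/germ_eq1.
(* Support is defined by germs of [Y0]: off the support [s] is 1 on a whole neighbourhood [W], and
   so is [t]. *)
have /germ_eq1[W [WX [Wx sW]]] := sx; exists W, WX; split=> //.
apply: functional_extensionality_dep => u.
exact: (tP (sub_pt WX u)).2 (congr1 (fun p : Y0 C W => p u) sW).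
Qed.

(** Sections of the cokernel sheaf are locally induced by classes of the presheaf quotient, and
    every class has a representative. *)
Lemma coker_proj_epi X (F G : presheaf X) (f : sheaf_hom F G) x
    (c : stalk (coker_sheaf f) x) :
  exists b, stalk_map (coker_proj f) x b = c.
Proof.
have [U [Ux [s ->]]] := germ_ex c.
have [V [VU [Vx [t ts]]]] := svalP s x Ux.
exists (germ (repr t) Vx); rewrite stalk_mapG.
suff -> : coker_proj f V (repr t) = res VU s by rewrite (germ_resE _ _ Ux).
by apply: subgT_inj; rewrite -[RHS]ts -[in RHS](qproj_repr t).
Qed.

(** Two localisations occur: a germ killed by the projection is killed in the presheaf quotient on a
    smaller open set, and there normality puts it in the range. *)
Lemma coker_proj_exact X (F G : presheaf X) (f : sheaf_hom F G) :
  (forall U : opens X, normal_set (range (f U))) -> exact_at f (coker_proj f).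
Proof.
move=> nf x b; split=> [|[a <-]].
  have [U [Ux [s ->]]] := germ_ex b; rewrite stalk_mapG.
  move=> /germ_eq1[W [WU [Wx]]]; rewrite -hom_res => /(congr1 sval).
  move=> /(congr1 (fun p : Y0 (coker_presheaf f) W => p (exist _ x Wx))).
  move=> /germ_eq1[V [VW [Vx]]].
  rewrite (coker_resE _ _ (res WU s)) => /nf[a _ fa].
  exists (germ a Vx).
  by rewrite stalk_mapG fa (germ_resE _ _ Wx) (germ_resE _ _ Ux).
have [U [Ux [s ->]]] := germ_ex a.
by rewrite !stalk_mapG coker_proj1 germ1.
Qed.

Lemma sheafify_map_unit X (P Q : presheaf X) (f : sheaf_hom P Q) (U : opens X) s :
  sheafify_map f U (sheafify_unit P U s) = sheafify_unit Q U (f U s).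
Proof. by apply: subgT_inj; apply/esym/nu_natural. Qed.

Lemma Z1_map_proj X (A B : sheaf X) (f : sheaf_hom A B) (U : opens X) s :
  Z1_map f U (coker_proj (nu A) U s) = coker_proj (nu B) U (Y0_map f U s).
Proof.
rewrite /Z1_map /coker_map.
apply: etrans (sheafify_map_unit _ _) _; congr (sheafify_unit _ _ _).
exact: quotg_mapE (coker_map_range (@nu_natural _ _ _ f) (U := U)) s.
Qed.

Lemma Z1_map_stalk X (A B : sheaf X) (f : sheaf_hom A B) x b :
  stalk_map (Z1_map f) x (stalk_map (coker_proj (nu A)) x b) =
  stalk_map (coker_proj (nu B)) x (stalk_map (Y0_map f) x b).
Proof.
have [U [Ux [s ->]]] := germ_ex b.
by rewrite !stalk_mapG Z1_map_proj.
Qed.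

Lemma nu_stalk X (A B : sheaf X) (f : sheaf_hom A B) x a :
  stalk_map (nu B) x (stalk_map f x a) = stalk_map (Y0_map f) x (stalk_map (nu A) x a).
Proof.
have [U [Ux [s ->]]] := germ_ex a.
by rewrite !stalk_mapG nu_natural.
Qed.

(* The nine lemma, with columns [F -> Y0 F -> Z1 F]. *)
Lemma Z1_short_exact X (A B C : sheaf X) (f : sheaf_hom A B) (g : sheaf_hom B C) :
  exact_at (nu A) (coker_proj (nu A)) ->
  exact_at (nu B) (coker_proj (nu B)) ->
  exact_at (nu C) (coker_proj (nu C)) ->
  short_exact f g -> short_exact (Z1_map f) (Z1_map g).
Proof.
move=> eA eB eC [mf fg epi_g].
have epi_Yg x c : exists b, stalk_map (Y0_map g) x b = c.
  have [U [Ux [s ->]]] := germ_ex c.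
  pose t : Y0 B U := fun u => sval (cid (epi_g (sval u) (s u))).
  exists (germ t Ux); rewrite stalk_mapG.
  suff -> : Y0_map g U t = s by [].
  by apply: functional_extensionality_dep => u; apply: svalP (cid (epi_g _ _)).
have Yfg := Y0_exact fg; split.
- move=> x; apply: amorph_inj => z; have [y <-] := coker_proj_epi z.
  rewrite Z1_map_stalk => /eB[b bfy].
  (* By naturality [nu C] sends [g b] to the image of [y] under [Y0 g] after [Y0 f], which is 1, and
     [nu C] is monic. *)
  have /fg[a fa] : stalk_map g x b = 1.
    apply: (@nu_monic _ C); rewrite amorph1 nu_stalk bfy.
    by apply/Yfg; exists y.
  have <- : stalk_map (nu A) x a = y.
    by apply: (Y0_monic mf); rewrite -nu_stalk fa.
  by apply/eA; exists a.
- move=> x z; have [y <-] := coker_proj_epi z; split=> [|[w <-]].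
    rewrite Z1_map_stalk => /eC[c cgy].
    have [b gb] := epi_g x c.
    (* Dividing [y] by the image of [b] under [nu B] makes it vanish under [Y0 g] and leaves its
       class in [Z1 B] unchanged. *)
    have /Yfg[y' fy'] :
        stalk_map (Y0_map g) x (y * (stalk_map (nu B) x b)^-1) = 1.
      by rewrite gmulfM amorphV -nu_stalk gb cgy amulgV.
    exists (stalk_map (coker_proj (nu A)) x y').
    rewrite Z1_map_stalk fy' gmulfM amorphV.
    have -> : stalk_map (coker_proj (nu B)) x (stalk_map (nu B) x b) = 1.
      by apply/eB; exists b.
    by rewrite ainv1 amulg1.
  have [v <-] := coker_proj_epi w; rewrite !Z1_map_stalk.
  have -> : stalk_map (Y0_map g) x (stalk_map (Y0_map f) x v) = 1.
    by apply/Yfg; exists v.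
  exact: amorph1.
- move=> x z; have [y <-] := coker_proj_epi z.
  have [y' <-] := epi_Yg x y.
  by exists (stalk_map (coker_proj (nu B)) x y'); rewrite Z1_map_stalk.
Qed.

(** * The canonical resolvent and its functoriality *)

Lemma hom_comp_stalk X (F G H : presheaf X) (g : sheaf_hom G H)
    (f : sheaf_hom F G) x a :
  stalk_map (hom_comp g f) x a = stalk_map g x (stalk_map f x a).
Proof.
by have [U [Ux [s ->]]] := germ_ex a; rewrite !stalk_mapG.
Qed.

(** The differential is the cokernel projection followed by the monic [nu], so both have the same
    kernel. *)
Lemma Yc_diff_eq1 X (F : sheaf X) m x b :
  stalk_map (Yc_diff F m) x b = 1 <->
  stalk_map (coker_proj (nu (Zc F m))) x b = 1.
Proof.
rewrite hom_comp_stalk; split=> [b1|->]; last exact: amorph1.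
by apply: (@nu_monic _ (Zc F m.+1)); rewrite amorph1.
Qed.

(** Splits the long exact sequence into the pieces [Zc m -> Yc m -> Zc m.+1]. Since the projections
    are epic and [nu] is monic, images and kernels of the differentials are those of the pieces. *)
Lemma canonical_resolventP X (F : sheaf X) :
  resolvent (L := canonical F) (nu F) <->
  forall m, exact_at (nu (Zc F m)) (coker_proj (nu (Zc F m))).
Proof.
split=> [[_ e0 eS] [|m] x b|eZ].
- by rewrite -Yc_diff_eq1; apply: e0.
- rewrite -Yc_diff_eq1; split.
    move=> /eS[a <-]; exists (stalk_map (coker_proj (nu (Zc F m))) x a).
    exact/esym/(hom_comp_stalk (nu (Zc F m.+1))).
  move=> [z <-]; have [a <-] := coker_proj_epi z.
  by apply/eS; exists a; apply: (hom_comp_stalk (nu (Zc F m.+1))).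
split=> [|x b|m x b]; first exact: nu_monic.
- exact: iff_trans (@Yc_diff_eq1 _ F 0 x b) (eZ 0%N x b).
- split=> [/Yc_diff_eq1/eZ[z <-]|[a <-]].
    have [a <-] := coker_proj_epi z.
    by exists a; apply: (hom_comp_stalk (nu (Zc F m.+1))).
  apply/Yc_diff_eq1/eZ; exists (stalk_map (coker_proj (nu (Zc F m))) x a).
  exact/esym/(hom_comp_stalk (nu (Zc F m.+1))).
Qed.

Lemma Zc_short_exact X (A B C : sheaf X) (f : sheaf_hom A B) (g : sheaf_hom B C) :
  resolvent (L := canonical A) (nu A) ->
  resolvent (L := canonical B) (nu B) ->
  resolvent (L := canonical C) (nu C) ->
  short_exact f g -> forall m, short_exact (Zc_map f m) (Zc_map g m).
Proof.
move=> /canonical_resolventP eA /canonical_resolventP eB.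
move=> /canonical_resolventP eC fg; elim=> // m IHm.
exact: Z1_short_exact.
Qed.

Lemma Yc_map_diff X (A B : sheaf X) (f : sheaf_hom A B) m (U : opens X) s :
  Yc_map f m.+1 U (Yc_diff A m U s) = Yc_diff B m U (Yc_map f m U s).
Proof.
transitivity (nu (Zc B m.+1) U
  (Z1_map (Zc_map f m) U (coker_proj (nu (Zc A m)) U s))).
  exact/esym/nu_natural.
by rewrite Z1_map_proj.
Qed.

Lemma Yc_map_nu X (A B : sheaf X) (f : sheaf_hom A B) (U : opens X) s :
  Yc_map f 0 U (nu A U s) = nu B U (f U s).
Proof. exact/esym/nu_natural. Qed.

(** * Isomorphisms given as relations *)

(** The connecting maps and [kappa] are defined as relations; this turns each into a morphism once
    it is total, single-valued and multiplicative. *)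
Lemma rel_morphism (G H : altGroupType) (r : G -> H -> Prop) :
  (forall g, exists h, r g h) ->
  (forall g h h', r g h -> r g h' -> h = h') ->
  (forall g g' h h', r g h -> r g' h' -> r (g * g') (h * h')) ->
  exists f : {multiplicative G -> H}, forall g h, r g h <-> f g = h.
Proof.
move=> total_r fun_r mul_r; have [f fP] := choice total_r.
have fM : {morph f : x y / x * y}.
  by move=> x y; apply: (fun_r (x * y)) => //; apply: mul_r.
exists (bundle_hom fM) => g h; split=> [rgh|<- //].
exact: (fun_r g).
Qed.

Lemma inj_surj_bij (A B : Type) (f : A -> B) :
  injective f -> (forall b, exists a, f a = b) -> bijective f.
Proof.
move=> fI /choice[f' f'K]; exists f' => // a.
by apply: fI; rewrite f'K.
Qed.

Lemma isomorphism_comp (G H K : altGroupType) (r : G -> H -> Prop)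
    (s : H -> K -> Prop) :
  isomorphism r -> isomorphism s ->
  isomorphism (fun g k => exists h, r g h /\ s h k).
Proof.
move=> [f [bf fP]] [f' [bf' fP']]; exists (f' \o f).
split=> [|g k]; first exact: bij_comp.
split=> [[h [/fP <- /fP' //]]|<-].
by exists (f g); split; [apply/fP | apply/fP'].
Qed.

Lemma comp_bij_morphism (S H K : altGroupType) (t : {multiplicative S -> H})
    (c : {multiplicative H -> K}) :
  bijective c -> (forall h, exists s, t s = h) ->
  exists u : {multiplicative S -> K},
    [/\ forall s, u s = c (t s), forall k, exists s, u s = k &
        forall s, u s = 1 <-> t s = 1].
Proof.
move=> c_bij t_surj; exists (c \o t); split=> // [k|s].
  have [c' _ c'K] := c_bij; have [s sk] := t_surj (c' k).
  by exists s; rewrite /= sk.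
split=> [|/= ->]; last exact: amorph1.
by rewrite -(amorph1 c) => /(bij_inj c_bij).
Qed.

(** The first isomorphism theorem: [i] identifies [S] with [A], and [t] carried over to [A] is onto
    [K] with kernel [N]. *)
Lemma quotg_isomorphism (S G K : altGroupType) (A : subgroup G)
    (N : set (subgT A)) (i : {multiplicative S -> G})
    (t : {multiplicative S -> K}) :
  injective i -> (forall s, A (i s)) -> (forall z : subgT A, exists s, i s = sval z) ->
  (forall k, exists s, t s = k) ->
  (forall s (z : subgT A), i s = sval z -> t s = 1 <-> N z) ->
  isomorphism (fun (h : quotg N) k =>
    exists z s, [/\ qproj N z = h, i s = sval z & t s = k]).
Proof.
move=> i_inj Ai i_surj t_surj tN; have [j jP] := choice i_surj.
have tjM : {morph t \o j : x y / x * y}.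
  move=> x y /=; rewrite -gmulfM; congr (t _).
  by apply: i_inj; rewrite gmulfM !jP.
pose u : {multiplicative subgT A -> K} := bundle_hom tjM.
have uE s z : i s = sval z -> u z = t s.
  by move=> isz; rewrite /u /=; congr (t _); apply: i_inj; rewrite jP.
have uN z : u z = 1 <-> N z by rewrite (uE (j z)) //; apply: tN.
(* As [N] is the kernel of [u], the congruence it generates is exactly equality of values of [u]. *)
have u_qproj z z' : qproj N z = qproj N z' <-> u z = u z'.
  split=> [/(qprojP N z z')|uz]; first by apply: gencong_morph => n /uN.
  apply/(qprojP N z z'); apply: gencong_div; apply/uN.
  by rewrite gmulfM amorphV uz amulgV.
have [||| f fP] := @rel_morphism (quotg N) K (fun h k =>
  exists z s, [/\ qproj N z = h, i s = sval z & t s = k]).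
- move=> h; exists (t (j (repr h))), (repr h), (j (repr h)).
  by split=> //; apply: qproj_repr.
- move=> h k k' [z [s [zh /uE us sk]]] [z' [s' [zh' /uE us' sk']]].
  by rewrite -sk -sk' -us -us'; apply/u_qproj; rewrite zh.
- move=> h h' k k' [z [s [<- us <-]]] [z' [s' [<- us' <-]]].
  exists (z * z'), (s * s').
  by split; [apply: (qprojM N z z') | rewrite gmulfM us us' | apply: gmulfM].
exists f; split=> //; apply: inj_surj_bij.
  move=> h h' fhh; have /fP[z [s [zh /uE us sk]]] := erefl (f h).
  have /fP[z' [s' [zh' /uE us' sk']]] := erefl (f h').
  by rewrite -zh -zh'; apply/u_qproj; rewrite us us' sk sk'.
move=> k; have [s sk] := t_surj k.
exists (qproj N (exist _ (i s) (Ai s))); apply/fP.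
by exists (exist _ (i s) (Ai s)), s.
Qed.

(** * Cohomology in degree 0 *)

Lemma coh_classP X (phi : supports X) (L : diff_sheaf X) m
    (z z' : cocycle phi L m) :
  normal_set (@coboundary X phi L m) ->
  coh_class z = coh_class z' <-> coboundary (z * z'^-1).
Proof. exact: normal_setP. Qed.

Definition mk_cocycle X (phi : supports X) (L : diff_sheaf X) m (s : Gamma phi (L m))
    (ds : Gamma_map phi (differential L m) s = 1) : cocycle phi L m :=
  exist _ s ds.

(** Exactness at [Yc F 0] identifies sections with cocycles of degree 0. The only coboundary there
    is 1, and normality of this trivial set makes distinct cocycles distinct classes. *)
Lemma H0_isomorphism X (phi : supports X) (F : sheaf X) :
  canonical_cohomology phi F -> isomorphism (@H0_of X phi F).
Proof.
move=> [[nu_mono nu_exact _] normF].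
have H0_inv (z : cocycle phi (canonical F) 0) :
    exists s, Gamma_map phi (nu F) s = sval z.
  exact: Gamma_exact nu_mono nu_exact _ (svalP z).
have [||| f fP] := @rel_morphism _ _ (@H0_of X phi F).
- move=> s; pose z := mk_cocycle (@Gamma_comp1 _ phi _ _ _ _ _ nu_exact s).
  by exists (coh_class z), z.
- move=> s h h' [z [zs <-]] [z' [zs' <-]].
  by congr (coh_class _); apply: subgT_inj; rewrite zs.
- move=> s s' h h' [z [zs <-]] [z' [zs' <-]]; exists (z * z'); split.
    by rewrite gmulfM -zs -zs'.
  exact: qprojM.
exists f; split=> //; apply: inj_surj_bij; last first.
  move=> h; have [s sz] := H0_inv (repr h); exists s; apply/fP.
  by exists (repr h); split=> //; apply: qproj_repr.
apply: amorph_inj => s /fP[z [zs /(normF 0%N)z1]].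
by apply: (Gamma_monic nu_mono); rewrite -zs z1 amorph1.
Qed.

Lemma Gamma_Yc_diff2 X (phi : supports X) (A : sheaf X) v (s : Gamma phi (Yc A v)) :
  Gamma_map phi (Yc_diff A v.+1) (Gamma_map phi (Yc_diff A v) s) = 1.
Proof. by apply: subgT_inj; apply: Yc_diff_diff. Qed.

Lemma Gamma_Yc_map_diff X (phi : supports X) (A B : sheaf X) (f : sheaf_hom A B)
    v (s : Gamma phi (Yc A v)) :
  Gamma_map phi (Yc_map f v.+1) (Gamma_map phi (Yc_diff A v) s) =
  Gamma_map phi (Yc_diff B v) (Gamma_map phi (Yc_map f v) s).
Proof. by apply: subgT_inj; apply: Yc_map_diff. Qed.

(** * The connecting homomorphism and its exactness properties *)

Section Connecting.
Context (X : topologicalType) (phi : supports X) (A B C : sheaf X)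
  (f : sheaf_hom A B) (g : sheaf_hom B C).
Hypotheses (canA : canonical_cohomology phi A)
  (canB : canonical_cohomology phi B) (canC : canonical_cohomology phi C)
  (fg : short_exact f g).

Local Notation gf v := (Gamma_map phi (Yc_map f v)).
Local Notation gg v := (Gamma_map phi (Yc_map g v)).
Local Notation gd F v := (Gamma_map phi (Yc_diff F v)).

Let Zfg v : short_exact (Zc_map f v) (Zc_map g v).
Proof. by case: canA canB canC => ? _ [? _] [? _]; apply: Zc_short_exact. Qed.

Let gf_inj v : injective (gf v).
Proof. by case: (Zfg v) => mf _ _; apply: Gamma_monic; apply: Y0_monic. Qed.

Let gf_gg v s : gg v (gf v s) = 1.
Proof. by case: (Zfg v) => _ e _; apply: Gamma_comp1; apply: Y0_exact. Qed.

Let gg_ker v s : gg v s = 1 -> exists a, gf v a = s.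
Proof.
case: (Zfg v) => mf e _.
exact: (Gamma_exact (Y0_monic mf) (Y0_exact e)).
Qed.

Let gg_surj v s : exists b, gg v b = s.
Proof. by case: (Zfg v) => _ _ e; exact: (Gamma_Y0_epi e s). Qed.

Let coboundary_lift v (c : cocycle phi (canonical C) v) :
  coboundary c -> exists w, gd B v w = 1 /\ gg v w = sval c.
Proof.
(* In degree 0 the cochain 1 is a lift; in higher degree lift the primitive [e] first and then apply
   the differential. *)
case: v c => [|v] c; first by move=> ->; exists 1; rewrite !amorph1.
move=> [e ec]; have [w we] := gg_surj e; exists (gd B v w).
by split; [apply: Gamma_Yc_diff2 | rewrite Gamma_Yc_map_diff we].
Qed.

(** The snake construction on canonical resolvents: lift [c] to [b], differentiate, and pull back
    along the injective map from [A]. *)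
Lemma connecting_morphism v :
  exists d : {multiplicative sheaf_coh phi C v -> sheaf_coh phi A v.+1},
    forall h k, connecting f g h k <-> d h = k.
Proof.
apply: rel_morphism.
- move=> h; have [b bh] := gg_surj (sval (repr h)).
  have [a ab] : exists a, gf v.+1 a = gd B v b.
    apply: gg_ker; rewrite Gamma_Yc_map_diff bh.
    exact: (svalP (repr h)).
  have az : gd A v.+1 a = 1.
    by apply: gf_inj; rewrite Gamma_Yc_map_diff ab Gamma_Yc_diff2 amorph1.
  pose a' : cocycle phi (canonical A) v.+1 := mk_cocycle (L := canonical A) az.
  exists (coh_class a'), (repr h), b, a'; split=> //.
  exact: qproj_repr.
- move=> h k k' [c [b [a [ch bc ab ak]]]] [c' [b' [a' [ch' bc' ab' ak']]]].
  rewrite -ak -ak'; apply/(coh_classP _ _ (canA.2 v.+1)).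
  have : coh_class c = coh_class c' by rewrite ch.
  move=> /(coh_classP _ _ (canC.2 v))/coboundary_lift[w [dw wc]].
  (* [w] is a cocycle lifting [c * c'^-1], so dividing by it brings [b * b'^-1] into the image of
     [A] without changing the differential. *)
  have [e eb] : exists e, gf v e = (b * b'^-1) * w^-1.
    apply: gg_ker; rewrite !gmulfM !amorphV wc bc bc'.
    exact: amulgV.
  exists e; apply: gf_inj; rewrite Gamma_Yc_map_diff eb !gmulfM !amorphV dw.
  by rewrite ainv1 amulg1 -ab -ab' -amorphV -gmulfM.
- move=> h h' k k' [c [b [a [ch bc ab ak]]]] [c' [b' [a' [ch' bc' ab' ak']]]].
  exists (c * c'), (b * b'), (a * a'); rewrite -ch -ch' -ak -ak'; split.
  + exact: qprojM.
  + by rewrite gmulfM bc bc'.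
  + by rewrite gmulfM -ab -ab' -gmulfM.
  + exact: qprojM.
Qed.

(** If [a] is the coboundary of [e], then dividing [b] by the image of [e] yields a cocycle of [B]
    that still lifts [c]. *)
Lemma connecting_ker v h :
  connecting f g h (1 : sheaf_coh phi A v.+1) ->
  exists (c : cocycle phi (canonical C) v) (w : cocycle phi (canonical B) v),
    coh_class c = h /\ gg v (sval w) = sval c.
Proof.
move=> [c [b [a [ch bc ab]]]] /(canA.2 v.+1)[e ea].
have wz : gd B v (b * (gf v e)^-1) = 1.
  by rewrite gmulfM amorphV -Gamma_Yc_map_diff -ab ea amulgV.
exists c, (mk_cocycle (L := canonical B) wz); split=> //.
suff : gg v (b * (gf v e)^-1) = sval c by [].
by rewrite gmulfM amorphV gf_gg ainv1 amulg1.
Qed.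

Hypothesis acB : acyclic phi B.

(** The image of [a] in [B] is a cocycle of positive degree, hence by acyclicity the coboundary of
    some [b]; the image of [b] in [C] is the required cocycle. *)
Lemma connecting_surj v (k : sheaf_coh phi A v.+1) :
  exists h, connecting f g h k.
Proof.
have [a <-] : exists a, coh_class a = k by exists (repr k); apply: qproj_repr.
have faz : gd B v.+1 (gf v.+1 (sval a)) = 1.
  rewrite -Gamma_Yc_map_diff.
  by rewrite (svalP a : gd A v.+1 (sval a) = 1) amorph1.
have /(canB.2 v.+1)[b bfa] := acB (ltn0Sn v)
  (coh_class (mk_cocycle (L := canonical B) faz)).
have cz : gd C v (gg v b) = 1.
  by rewrite -Gamma_Yc_map_diff bfa gf_gg.
pose c := mk_cocycle (L := canonical C) cz.
exists (coh_class c), c, b, a; split; [by []| by []| exact: esym bfa | by []].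
Qed.

Lemma connecting_isomorphism v : (0 < v)%N ->
  isomorphism (@connecting X phi A B C f g v).
Proof.
move=> v0; have [d dP] := connecting_morphism v; exists d; split=> //.
apply: inj_surj_bij; last first.
  by move=> k; have [h /dP] := connecting_surj k; exists h.
apply: amorph_inj => h /dP/connecting_ker[c [w [<- wc]]].
apply/(canC.2 v); have := acB v0 (coh_class w); move/(canB.2 v).
(* Positivity of [v] gives a primitive [b] of [w], and its image in [C] is a primitive of [c]. *)
case: v v0 {d dP h} c w wc => // v _ c w wc [b bw].
exists (gg v b); apply: etrans (esym (Gamma_Yc_map_diff _ _)) _.
by rewrite bw.
Qed.

(** The beginning of the long exact sequence, [Gamma B -> Gamma C -> H^1(A) -> 0], after identifying
    [Gamma C] with degree 0 cohomology. *)
Lemma connecting0_morphism : exists t :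
    {multiplicative Gamma phi C -> sheaf_coh phi A 1},
  [/\ forall s k, (exists h, H0_of s h /\ connecting f g h k) <-> t s = k,
      forall k, exists s, t s = k &
      forall s, t s = 1 <-> exists b, Gamma_map phi g b = s].
Proof.
have [d dP] := connecting_morphism 0.
have [e [e_bij eP]] := H0_isomorphism canC.
have [nu_mono nu_exact _] := canB.1.
exists (d \o e); split=> [s k|k|s].
- split=> [[h [/eP <- /dP //]]|<-].
  by exists (e s); split; [apply/eP | apply/dP].
- have [h /dP hk] := connecting_surj k; have [e' _ e'K] := e_bij.
  by exists (e' h); rewrite /= e'K.
split=> [/dP/connecting_ker[c [w [cs wc]]]|[b <-]].
  have [b bw] := Gamma_exact nu_mono nu_exact (svalP w).
  exists b; apply: (bij_inj e_bij); rewrite -cs; apply/eP.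
  exists c; split=> //; rewrite -wc -bw.
  by apply: subgT_inj; apply: Yc_map_nu.
apply/dP.
have [_ nuC_exact _] := canC.1.
pose z := mk_cocycle (@Gamma_comp1 _ phi _ _ _ _ _ nuC_exact (Gamma_map phi g b)).
(* The lift coming from a genuine section of [B] has trivial differential, so the snake ends at
   1. *)
exists z, (Gamma_map phi (nu B) b), 1; split.
- by apply/esym/eP; exists z.
- by apply: subgT_inj; apply: Yc_map_nu.
- by rewrite amorph1; apply/esym/Gamma_comp1.
- by [].
Qed.

End Connecting.

(** * The commutative case *)

Lemma commutative_subgT (G : altGroupType) (A : subgroup G) :
  commutative_group G -> commutative_group (subgT A).
Proof. by move=> [cG aG]; split=> *; apply: subgT_inj; [apply: cG | apply: aG]. Qed.

Lemma commutative_quotg (G : altGroupType) (N : set G) :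
  commutative_group G -> commutative_group (quotg N).
Proof.
move=> [cG aG]; split=> a b; rewrite -(qproj_repr a) -(qproj_repr b).
  by rewrite -(qprojM N (repr a)) -(qprojM N (repr b)) cG.
move=> c; rewrite -(qproj_repr c); move: (repr a) (repr b) (repr c) => {}a {}b {}c.
by rewrite -(qprojM N b c) -(qprojM N a b) -(qprojM N a) -(qprojM N (a * b)) aG.
Qed.

Lemma commutative_stalk X (F : presheaf X) x :
  (forall U : opens X, commutative_group (F U)) -> commutative_group (stalk F x).
Proof.
move=> cF; split=> a b.
  have [U [Ux [s [t [-> ->]]]]] := germ_ex2 a b.
  by rewrite -!germM (cF U).1.
move=> c; have [U [Ux [s [t [-> ->]]]]] := germ_ex2 a b.
have [V [Vx [r ->]]] := germ_ex c.
have UVx : capO U V x by split.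
rewrite -(germ_resE (@capOl X U V) s Ux UVx) -(germ_resE (@capOl X U V) t Ux UVx).
rewrite -(germ_resE (@capOr X U V) r Vx UVx) -!germM.
by rewrite (cF (capO U V)).2.
Qed.

Lemma commutative_Y0 X (F : presheaf X) :
  (forall U : opens X, commutative_group (F U)) -> commutative_sheaf (Y0 F).
Proof.
move=> cF U; split=> *; apply: functional_extensionality_dep => u.
  exact: (commutative_stalk _ cF).1.
exact: (commutative_stalk _ cF).2.
Qed.

Lemma commutative_Zc X (F : sheaf X) m :
  commutative_sheaf F -> commutative_sheaf (Zc F m).
Proof.
move=> cF; elim: m => //= m IHm U; apply: commutative_subgT.
apply: commutative_Y0 => V; apply: commutative_quotg.
exact: commutative_Y0.
Qed.

Definition rangeg (G H : altGroupType) (f : {multiplicative G -> H}) : subgroup H.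
Proof.
apply: (@Subgroup _ (range f)).
- by exists 1 => //; apply: amorph1.
- by move=> _ _ [a _ <-] [b _ <-]; exists (a * b) => //; apply: gmulfM.
- by move=> _ [a _ <-]; exists a^-1 => //; apply: amorphV.
Defined.

Definition coboundaryg X (phi : supports X) (L : diff_sheaf X) m :
  subgroup (cocycle phi L m).
Proof.
apply: (@Subgroup _ (@coboundary X phi L m)); case: m => [|m] //.
- by exists 1; apply: amorph1.
- by move=> a b -> ->; apply: amul1g.
- by move=> a b [c ca] [d db]; exists (c * d); rewrite gmulfM ca db.
- by move=> a ->; apply: ainv1.
- by move=> a [c ca]; exists c^-1; rewrite amorphV ca.
Defined.

(** Commutativity passes through stalks, products, quotients and subgroups, so every range and every
    set of coboundaries involved is normal. *)
Lemma commutative_canonical X (phi : supports X) (F : sheaf X) :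
  commutative_sheaf F -> canonical_cohomology phi F.
Proof.
move=> cF; split=> [|m].
  apply/canonical_resolventP => m; apply: coker_proj_exact => U.
  apply: (commutative_normal (rangeg (nu (Zc F m) U))).
  exact/commutative_Y0/commutative_Zc.
apply: (commutative_normal (coboundaryg phi (canonical F) m)).
do 2!apply: commutative_subgT.
exact/commutative_Y0/commutative_Zc.
Qed.

(** * The short exact sequences of cycle sheaves *)

Lemma sub_incl_monic X (F : sheaf X) (A : subsheaf F) : monic (sub_incl A).
Proof. by apply: sec_monic => U s t /subgT_inj. Qed.

(** The differential factors as [cyc_out] followed by a monic inclusion, so kernels agree, and
    exactness at [L m.+1] becomes surjectivity of [cyc_out] on stalks. *)
Lemma cyc_short_exact X (B : sheaf X) (L : diff_sheaf X) (eps : sheaf_hom B (L 0)) :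
  resolvent eps -> forall m, short_exact (cyc_in eps m) (cyc_out eps m).
Proof.
move=> [eps_mono eps_exact L_exact] m.
have incl_out x b : stalk_map (sub_incl (ker_sheaf (differential L m.+1))) x
    (stalk_map (cyc_out eps m) x b) = stalk_map (differential L m) x b.
  by have [U [Ux [s ->]]] := germ_ex b; rewrite !stalk_mapG.
have out1 x b : stalk_map (cyc_out eps m) x b = 1 <->
    stalk_map (differential L m) x b = 1.
  rewrite -incl_out; split=> [->|b1]; first exact: amorph1.
  by apply: (sub_incl_monic (A := ker_sheaf (differential L m.+1))); rewrite b1 amorph1.
split.
- by case: m {incl_out out1} => [//|m]; apply: sub_incl_monic.
- move=> x b; rewrite out1 {incl_out out1}; case: m b => [|m] b.
    exact: eps_exact.
  move: x b; apply: sec_exact => U s; split=> [ds|[a <-]]; last exact: svalP a.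
  by exists (exist _ s ds).
- move=> x c; have [U [Ux [s cs]]] := germ_ex c.
  have /L_exact[b bs] : stalk_map (differential L m.+1) x (germ (sval s) Ux) = 1.
    by rewrite stalk_mapG (svalP s : differential L m.+1 U (sval s) = 1) germ1.
  exists b; apply: (sub_incl_monic (A := ker_sheaf (differential L m.+1))).
  by rewrite incl_out bs cs stalk_mapG.
Qed.

(** * Dimension shifting and the map [kappa] *)

Section Kappa.
Context (X : topologicalType) (phi : supports X) (B : sheaf X)
  (L : diff_sheaf X) (eps : sheaf_hom B (L 0)).
Hypotheses (canL : forall m, canonical_cohomology phi (L m))
  (canZ : forall m, canonical_cohomology phi (cyc eps m))
  (res_eps : resolvent eps) (acL : forall m, acyclic phi (L m)).

(** Each step lowers [i] and raises [v], preserving [v + i]; starting at [0 < v] keeps every step in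
    the range where acyclicity makes it bijective. *)
Lemma connecting_chain_isomorphism n i v : n = (v + i)%N -> (0 < v)%N ->
  isomorphism (@connecting_chain X phi B L eps n i v).
Proof.
elim: i v => [|i IHi] v nE v0.
  (* With [n = v] the transport is along a proof of [v = v], which is [erefl], so the empty chain is
     the identity. *)
  rewrite addn0 in nE; subst n; exists idfun.
  split=> [|h k]; first by exists idfun.
  by split=> [[vn]|<-]; [rewrite eq_axiomK | exists erefl].
apply: (isomorphism_comp _ (IHi v.+1 _ isT)); last by rewrite addSnnS.
exact: (connecting_isomorphism (canZ i) (canL i) (canZ i.+1)
  (cyc_short_exact res_eps i) (@acL i) v0).
Qed.

Lemma Gamma_cyc_in b :
  [/\ injective (Gamma_map phi (cyc_in eps b)),
      forall s, Gamma_map phi (differential L b) (Gamma_map phi (cyc_in eps b) s) = 1 &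
      forall z : cocycle phi L b, exists s, Gamma_map phi (cyc_in eps b) s = sval z].
Proof.
have [mono exact_out _] := cyc_short_exact res_eps b.
have in_exact : exact_at (cyc_in eps b) (differential L b).
  case: b mono exact_out => [|b] mono exact_out; first by case: res_eps.
  apply: sec_exact => U s; split=> [ds|[a <-]]; last exact: svalP a.
  by exists (exist _ s ds).
split; first exact: Gamma_monic.
  by move=> s; apply: Gamma_comp1.
by move=> z; apply: Gamma_exact mono in_exact _ (svalP z).
Qed.

(** The chain of connecting maps gives a surjection [t] from sections of [cyc eps b] whose kernel
    corresponds to the coboundaries, and [kappa] is the induced map on the quotient. *)
Lemma kappa_isomorphism b : isomorphism (kappa phi eps b).
Proof.
have [in_inj in_ker in_surj] := Gamma_cyc_in b.
have [t [tP t_surj t_ker]] :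
    exists t : {multiplicative Gamma phi (cyc eps b) -> sheaf_coh phi B b},
    [/\ forall s k, (exists h, H0_of s h /\ connecting_chain h k) <-> t s = k,
        forall k, exists s, t s = k &
        forall s (z : cocycle phi L b),
          Gamma_map phi (cyc_in eps b) s = sval z -> t s = 1 <-> coboundary z].
  (* For [b = 0] the chain is empty and [t] is the identification of sections with degree 0 classes.
     Otherwise the first connecting map, out of degree 0, is merely surjective, and the remaining
     chain from degree 1 is bijective. *)
  case: b in_inj in_ker in_surj => [|b] in_inj in_ker in_surj.
    have [t [t_bij tP]] := H0_isomorphism (canZ 0).
    exists t; split=> [s k|k|s z sz].
    - split=> [[h [/tP <- [vn]]]|<-]; first by rewrite eq_axiomK.
      by exists (t s); split; [apply/tP | exists erefl].
    - by have [t' _ t'K] := t_bij; exists (t' k).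
    split=> [|z1].
      rewrite -(amorph1 t) => /(bij_inj t_bij) s1.
      by apply: subgT_inj; rewrite -sz s1 amorph1.
    suff -> : s = 1 by exact: amorph1.
    by apply: in_inj; rewrite sz z1 amorph1.
  have [t [tP t_surj t_ker]] := connecting0_morphism (canZ b) (canL b) (canZ b.+1)
    (cyc_short_exact res_eps b) (@acL b).
  have [c [c_bij cP]] := @connecting_chain_isomorphism b.+1 b 1 erefl erefl.
  have [u [uE u_surj u_ker]] := comp_bij_morphism c_bij t_surj.
  exists u; split=> // [s k|s z sz].
    rewrite uE; split=> [[h [sh [h' [hh' /cP <-]]]]|<-].
      by congr (c _); apply/(tP s h'); exists h.
    have [h [sh hh]] := (tP s (t s)).2 erefl.
    by exists h; split=> //; exists (t s); split=> //; apply/cP.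
  rewrite u_ker t_ker; split=> [[w ws]|[w wz]]; exists w.
    by rewrite -sz -ws; apply: subgT_inj.
  by apply: in_inj; rewrite sz -wz; apply: subgT_inj.
have [f [f_bij fP]] := quotg_isomorphism
  (A := kerg (Gamma_map phi (differential L b))) in_inj in_ker in_surj t_surj t_ker.
exists f; split=> // h k; split=> [[z [s [h0 [zh sz sh hk]]]]|/(fP h k)].
  apply/(fP h k); exists z, s; split; [exact: zh | exact: sz |].
  by apply/(tP s k); exists h0.
move=> [z [s [zh sz /(tP s k)[h0 [sh hk]]]]].
by exists z, s, h0.
Qed.

End Kappa.

Theorem theorem48p1 (X : topologicalType) (phi : supports X)
    (B : sheaf X) (L : diff_sheaf X) (eps : sheaf_hom B (L 0)) :
  commutative_case B L \/ twisted_case phi eps ->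
  resolvent eps ->
  (forall m : nat, acyclic phi (L m)) ->
  forall b : nat, isomorphism (kappa phi eps b).
Proof.
move=> cases res_eps acL.
(* Both cases enter only through this property; in the commutative case each [cyc eps m] is [B] or a
   subsheaf of [L m], hence commutative. *)
have can m : canonical_cohomology phi (L m) /\ canonical_cohomology phi (cyc eps m).
  case: cases => [[cB cL]|[r [_ _ _ can]]]; last exact: can.
  split; apply: commutative_canonical => //.
  by case: m => [//|m] U; apply: commutative_subgT; apply: cL.
by apply: kappa_isomorphism => // m; case: (can m).
Qed.
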